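(* If $(W,S)$ is a finite irreducible Coxeter system with Coxeter number $h$ and $k\ge 1$ is an integer, then \[\operatorname{TW}_k(W)\,=\,\frac{h}{2}\,\sum_{s\in S}\operatorname{TW}_{k-1}(W_{\langle s\rangle}).\]
   Context: Let $(W,S)$ be a finite Coxeter system of rank $n=|S|$ and let $T$ be the set of reflections of $W$ (all conjugates of elements of $S$). The absolute length $\ell_T(w)$ of $w\in W$ is the minimal length of a word in the alphabet $T$ representing $w$; a word in $T$ for $w$ of this minimal length is a reduced $T$-word for $w$. The absolute order on $W$ sets $u\le v$ if and only if $u$ has a reduced $T$-word which is a prefix of some reduced $T$-word for $v$. A Coxeter element is $c=s_1s_2\cdots s_n$ with each element of $S$ occurring exactly once. The noncrossing partition lattice $L_W$ is the interval $[1,c]$ in the absolute order; its isomorphism type does not depend on the choice of $c$, and it is graded of rank $n$ with rank function $\ell_T$. The Coxeter number $h$ of an irreducible $W$ is the order of a Coxeter element. $\operatorname{TW}_k(W)$ is the number of reduced $T$-words for elements of absolute length $k$ in $L_W$; equivalently, the number of chains $x_0<x_1<\cdots<x_k$ in $L_W$ with $\ell_T(x_i)=i$ for each $i$. For $s\in S$, $W_{\langle s\rangle}$ denotes the parabolic subgroup of $W$ generated by $S\setminus\{s\}$, regarded as a Coxeter system with simple reflections $S\setminus\{s\}$ and with its own set of reflections (possibly reducible or trivial). *)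

(* Defs.v *)
From mathcomp Require Import all_boot all_fingroup.
From mathcomp Require Import boolp.
Set Implicit Arguments. Unset Strict Implicit. Unset Printing Implicit Defensive.
Import GroupScope.

Definition wprod (gT : finGroupType) (w : seq gT) : gT := \prod_(x <- w) x.

(* The congruence on words generated by (st)^m(s,t) ~ 1 for s, t in S, where
   m(s,t) is the order of s * t in gT.  When the elements of S are involutions
   the case s = t is the relation ss ~ 1, so that words without formal
   inverses suffice to describe the group <S | (st)^m(s,t) = 1>. *)
Inductive coxeter_congr (gT : finGroupType) (S : {set gT}) :
    seq gT -> seq gT -> Prop :=
| CongrRefl u : coxeter_congr S u u
| CongrSym u v : coxeter_congr S u v -> coxeter_congr S v u
| CongrTrans u v w : coxeter_congr S u v -> coxeter_congr S v w -> coxeter_congr S u w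
| CongrRel u v s t : s \in S -> t \in S ->
    coxeter_congr S (u ++ flatten (nseq #[s * t] [:: s; t]) ++ v) (u ++ v).

(* Bourbaki's definition: S is a generating set of involutions of W, and the
   relations (st)^m(s,t) = 1, m(s,t) being the order of st in W, form a
   presentation of W. *)
Definition coxeter_system (gT : finGroupType) (W S : {set gT}) : Prop :=
  [/\ <<S>> = W,
      (forall s, s \in S -> #[s] = 2)
    & forall u v : seq gT, all (mem S) u -> all (mem S) v ->
        wprod u = wprod v -> coxeter_congr S u v].

(* The Coxeter graph (an edge for each s, t with m(s,t) >= 3) is nonempty and
   connected. *)
Definition coxeter_irreducible (gT : finGroupType) (S : {set gT}) : Prop :=
  S != set0 /\
  {in S &, forall s t,
     connect [rel x y | [&& x \in S, y \in S & 2 < #[x * y]]] s t}.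

Definition reflections (gT : finGroupType) (W S : {set gT}) : {set gT} :=
  [set s ^ w | s in S, w in W].

Definition word_for (gT : finGroupType) (T : {set gT}) (w : gT) (t : seq gT) :
  Prop := all (mem T) t /\ wprod t = w.

Definition reduced_word_for (gT : finGroupType) (T : {set gT}) (w : gT)
    (t : seq gT) : Prop :=
  word_for T w t /\ forall t', word_for T w t' -> size t <= size t'.

Definition abs_le (gT : finGroupType) (T : {set gT}) (u v : gT) : Prop :=
  exists p q : seq gT, reduced_word_for T u p /\ reduced_word_for T v (p ++ q).

Definition coxeter_element (gT : finGroupType) (S : {set gT}) (c : gT) : Prop :=
  exists2 r : seq gT, perm_eq r (enum S) & c = wprod r.

Definition coxeter_number (gT : finGroupType) (S : {set gT}) (h : nat) : Prop :=
  exists2 c, coxeter_element S c & h = #[c].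

Definition NC (gT : finGroupType) (W S : {set gT}) (c : gT) : {set gT} :=
  [set w | `[< abs_le (reflections W S) 1 w /\ abs_le (reflections W S) w c >]].

(* A reduced word with k letters represents an element of absolute length k.
   The number depends only on (W, S) and k when c ranges over the Coxeter
   elements; c is kept as a parameter instead of fixing one of them. *)
Definition TW (gT : finGroupType) (W S : {set gT}) (c : gT) (k : nat) : nat :=
  #|[set t : k.-tuple gT |
      (wprod t \in NC W S c)
      && `[< reduced_word_for (reflections W S) (wprod t) t >]]|.

(* Main.v *)
(* TW_k(W) is the sum over reflections t of the number g(t) of reduced words
   t t_2 ... t_k that are prefixes of reduced words of c, and g is invariant under
   conjugation by c.  Write c = s_1 ... s_n and t_i = s_1 ... s_i ... s_1.  Then
   t_i c is c without s_i, a Coxeter element of W_<s_i>, whose reduced reflection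
   words stay in W_<s_i>; so g(t_i) = TW_{k-1}(W_<s_i>).  It remains to see that
   among the nh reflections c^q t_i c^-q (q < h, i <= n) each reflection occurs
   exactly twice.

   The Coxeter graph is a forest, so all Coxeter elements are conjugate and we
   may take c = c_+ c_- bipartite.  A Perron-Frobenius eigenvector of the Coxeter
   matrix spans with the bipartition a plane of linear forms, stable under c_+
   and c_-, that meets the open chamber.  The chambers of c_+, c_+ c_-,
   c_+ c_- c_+, ... cut the plane into consecutive cones.  The values of a root on
   their rays satisfy f(j + 2) = la f(j + 1) - f(j), and they vanish exactly when
   the walk crosses the hyperplane of the root.  All solutions are antiperiodic
   with the same period, which is h, with one zero in each window of length h;
   hence two crossings during the 2h steps of c^h. *)
Require Import Defs.
From mathcomp Require Import Rstruct all_classical all_reals all_analysis.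
From mathcomp Require Import all_boot all_order all_algebra all_fingroup.
From mathcomp Require Import cyclic ring lra zify.
Set Implicit Arguments. Unset Strict Implicit. Unset Printing Implicit Defensive.
Import Order.TTheory GRing.Theory Num.Theory.
Import numFieldNormedType.Exports.
Local Open Scope ring_scope.

(** * Chebyshev recurrences *)

Section Chebyshev.
Variable R : realFieldType.
Implicit Types (a : R) (f : nat -> R) (k m : nat).

(* For a = 2 cos(t) this is sin(k t) / sin(t). *)
Fixpoint cheb a k : R :=
  if k is k'.+1 then (if k' is k''.+1 then a * cheb a k' - cheb a k'' else 1)
  else 0.

Arguments cheb : simpl never.

Lemma cheb0 a : cheb a 0 = 0. Proof. by []. Qed.
Lemma cheb1 a : cheb a 1 = 1. Proof. by []. Qed.
Lemma chebSS a k : cheb a k.+2 = a * cheb a k.+1 - cheb a k.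
Proof. by []. Qed.

Definition chebrec a f := forall k, f k.+2 = a * f k.+1 - f k.

Lemma chebrec_shift a f i : chebrec a f -> chebrec a (fun k => f (i + k)%N).
Proof. by move=> H k; rewrite !addnS H. Qed.

Lemma chebrecE a f k : chebrec a f ->
  f k.+1 = f 1%N * cheb a k.+1 - f 0%N * cheb a k.
Proof.
move=> H; suff [] : f k.+1 = f 1%N * cheb a k.+1 - f 0%N * cheb a k /\
  f k.+2 = f 1%N * cheb a k.+2 - f 0%N * cheb a k.+1 by [].
elim: k => [|k [IH1 IH2]]; first by rewrite H chebSS cheb0 cheb1; split; ring.
split=> //; rewrite H IH1 IH2 !chebSS; ring.
Qed.

Lemma chebrec_zero a f i k : chebrec a f -> f i = 0 ->
  f (i + k)%N = f i.+1 * cheb a k.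
Proof.
move=> H f0; case: k => [|k]; first by rewrite addn0 f0 cheb0 mulr0.
rewrite (chebrecE k (chebrec_shift i H)) addn0 f0 addn1; ring.
Qed.

(** The Casorati determinant of the recurrence is constant. At a zero of the sequence it forces the
    preceding value to be 1 or -1. *)
Lemma cheb_casorati a k : cheb a k.+1 ^+ 2 - cheb a k.+2 * cheb a k = 1.
Proof.
elim: k => [|k IH]; first by rewrite cheb1 cheb0; ring.
rewrite -[RHS]IH (chebSS a k.+1) (chebSS a k); ring.
Qed.

(** An algebraic form of [a] = 2 cos(pi/m): the values sin(k pi/m) / sin(pi/m) stay positive until
    their first zero at k = m. *)
Definition half_turn a m :=
  [/\ (0 < m)%N, cheb a m = 0 & forall k, (0 < k < m)%N -> 0 < cheb a k].

Section HalfTurn.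
Variables (a : R) (m : nat).
Hypothesis Hm : half_turn a m.

Lemma half_turn_gt1 : (1 < m)%N.
Proof.
case: Hm => m0 dm _; case: m m0 dm => [|[|//]] // _.
by rewrite cheb1 => /eqP; rewrite oner_eq0.
Qed.

Lemma cheb_half_turn_pred : cheb a m.-1 = 1.
Proof.
have m1 := half_turn_gt1; case: Hm => m0 dm dpos.
case: m m1 dm dpos => [|[|k]] // _ dm dpos /=.
have := cheb_casorati a k; rewrite dm mul0r subr0 => /eqP.
rewrite sqrf_eq1 => /orP[/eqP//|/eqP d1].
have := dpos k.+1; rewrite d1 ltnSn /= => /(_ isT); rewrite ltr0N1; lra.
Qed.

Lemma chebrec_half_turn f k : chebrec a f -> f (k + m)%N = - f k.
Proof.
have m1 := half_turn_gt1; have d1 := cheb_half_turn_pred.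
case: Hm => m0 dm dpos H.
have [] : f (k + m)%N = - f k /\ f (k.+1 + m)%N = - f k.+1; last by [].
elim: k => [|k [IH1 IH2]].
  case: m m1 dm dpos d1 => [|[|p]] // _ dm dpos /= d1.
  rewrite add0n add1n; split.
    rewrite (chebrecE p.+1 H) dm d1; ring.
  rewrite (chebrecE p.+2 H) dm chebSS dm d1; ring.
by split=> //; rewrite !addSn H -addSn IH1 IH2 H; ring.
Qed.

Lemma cheb_eq0 k : (0 < k < m)%N -> cheb a k != 0.
Proof. by case: Hm => _ _ H /H; rewrite lt0r => /andP[]. Qed.

(** For [a] at least 2 the sequence 0, 1, ... is nondecreasing and never returns to 0. *)
Lemma half_turn_lt2 : a < 2.
Proof.
case: Hm => m0 dm _; rewrite ltNge; apply/negP => a2.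
have : 0 <= cheb a m.-1 <= cheb a m.-1.+1 /\ 0 < cheb a m.-1.+1.
  elim: m.-1 => [|k [/andP[I1 I2] I3]]; first by rewrite cheb0 cheb1; lra.
  by rewrite chebSS; nra.
by rewrite prednK // dm; lra.
Qed.

Lemma half_turn_ge0 : 0 <= a.
Proof.
have m1 := half_turn_gt1; have [_ dm dpos] := Hm.
have d2 : cheb a 2 = a by rewrite chebSS cheb1 cheb0; ring.
move: m1; rewrite leq_eqVlt => /orP[/eqP m2|m2].
  by rewrite -d2 m2 dm.
by rewrite -d2 ltW // dpos.
Qed.

Lemma half_turn2 : m = 2%N -> a = 0.
Proof.
by move=> m2; case: Hm => _ + _; rewrite m2 chebSS cheb1 cheb0 subr0 mulr1.
Qed.

Lemma half_turn_ge1 : (2 < m)%N -> 1 <= a.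
Proof.
move=> m2; have [_ dm dpos] := Hm.
have a0 : 0 < a by have := dpos 2%N m2; rewrite chebSS cheb1 cheb0; lra.
have d3 : 0 <= cheb a 3.
  move: m2; rewrite leq_eqVlt => /orP[/eqP m3|m3]; first by rewrite m3 dm.
  by rewrite ltW // dpos.
rewrite !chebSS cheb1 cheb0 in d3; nra.
Qed.

(* Telescoping: (4 - a^2) f (k + 2) = (f (k + 2) - f (k + 4)) - (f k - f (k + 2)). *)
Lemma chebrec_sum_even f : chebrec a f -> \sum_(l < m) f l.*2 = 0.
Proof.
move=> H.
have per k : f (k + m.*2)%N = f k.
  by rewrite -addnn addnA !chebrec_half_turn // opprK.
have E : \sum_(l < m) f l.*2 = \sum_(l < m) f l.+1.*2.
  have [p mE] : exists p, m = p.+1 by case: m Hm => [[]|p _] //; exists p.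
  have pp : f p.+1.*2 = f 0%N by rewrite -mE -(per 0%N) add0n.
  by rewrite mE big_ord_recl [RHS]big_ord_recr /= pp addrC.
have : (4 - a ^+ 2) * \sum_(l < m) f l.+1.*2 = 0.
  rewrite mulr_sumr -(big_mkord predT (fun l => (4 - a ^+ 2) * f l.+1.*2)).
  rewrite (eq_bigr (fun l => (f l.+1.*2 - f l.+2.*2) - (f l.*2 - f l.+1.*2))).
    rewrite telescope_sumr // double0.
    have -> : m.+1.*2 = (2 + m.*2)%N by rewrite doubleS.
    have -> : m.*2 = (0 + m.*2)%N by [].
    by rewrite !per; ring.
  move=> l _; rewrite !doubleS.
  by rewrite (H l.*2.+2) (H l.*2.+1) (H l.*2); ring.
rewrite -E => /eqP; rewrite mulf_eq0 => /orP[|/eqP//].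
by have := half_turn_lt2; have := half_turn_ge0 => ? ?; nra.
Qed.

Section Zeros.
Variable f : nat -> R.
Hypotheses (Hf : chebrec a f)
  (fsgn : forall k, 0 <= f k * f k.+1)
  (fnz : forall k, (f k != 0) || (f k.+1 != 0)).

(** From a zero on, the solution is a nonzero multiple of [cheb a], whose next zero is [m] steps
    away. *)
Lemma chebrec_zero_uniq i j : (i < j < i + m)%N -> f i = 0 -> f j <> 0.
Proof.
move=> /andP[ij jm] f0; have -> : j = (i + (j - i))%N by lia.
rewrite (chebrec_zero _ Hf f0) => /eqP; rewrite mulf_eq0.
have := fnz i; rewrite f0 eqxx /= => /negPf -> /=.
by apply/negP/cheb_eq0; lia.
Qed.

(** Without a zero in the window no sign change could occur up to [i + m], against
    antiperiodicity. *)
Lemma chebrec_zero_ex i : exists2 j, (i <= j < i + m)%N & f j = 0.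
Proof.
have [m0 _ _] := Hm.
case: (pselect (exists2 j, (i <= j < i + m)%N & f j = 0)) => // no.
have nz j : (i <= j < i + m)%N -> f j != 0.
  by move=> ij; apply/eqP => f0; apply: no; exists j.
have pos k : (k <= m)%N -> 0 <= f i * f (i + k)%N.
  elim: k => [|k IH] km; first by rewrite addn0 -expr2 sqr_ge0.
  have := IH (ltnW km); have := fsgn (i + k)%N; rewrite addnS.
  have := nz (i + k)%N; rewrite leq_addr ltn_add2l km => /(_ isT) fk.
  have f2 : 0 < f (i + k)%N ^+ 2 by rewrite exprn_even_gt0.
  move=> h1 h2; have := mulr_ge0 h2 h1.
  have -> : f i * f (i + k)%N * (f (i + k)%N * f (i + k).+1)
     = f (i + k)%N ^+ 2 * (f i * f (i + k).+1) by ring.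
  by rewrite pmulr_rge0.
have := pos _ (leqnn m); rewrite chebrec_half_turn //.
have := nz i; rewrite leqnn -{1}(addn0 i) ltn_add2l m0 => /(_ isT) fi.
have f2 : 0 < f i ^+ 2 by rewrite exprn_even_gt0.
by rewrite mulrN -expr2; lra.
Qed.

Lemma chebrec_count_zero i : (\sum_(i <= j < i + m) (f j == 0)%R = 1)%N.
Proof.
have [j0 ij0 fj0] := chebrec_zero_ex i.
rewrite (bigD1_seq j0) ?iota_uniq ?mem_index_iota //= fj0 eqxx big_nat_cond big1 ?addn0 //.
move=> j /andP[ij jj0]; apply/eqP; rewrite eqb0; apply/negP => /eqP fj.
move: jj0; rewrite neq_ltn => /orP[lt|lt].
  by apply: (@chebrec_zero_uniq j j0) => //; lia.
by apply: (@chebrec_zero_uniq j0 j) => //; lia.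
Qed.

End Zeros.
End HalfTurn.
End Chebyshev.
Arguments cheb : simpl never.

Lemma cheb_cos (R : realType) (x : R) k :
  cheb (2 * cos x) k * sin x = sin (k%:R * x).
Proof.
suff [] : cheb (2 * cos x) k * sin x = sin (k%:R * x) /\
  cheb (2 * cos x) k.+1 * sin x = sin (k.+1%:R * x) by [].
elim: k => [|k [I1 I2]]; first by rewrite cheb0 cheb1 !mul0r sin0 !mul1r.
split=> //; rewrite chebSS mulrBl -mulrA I2 I1.
have -> : k%:R * x = k.+1%:R * x - x by rewrite -natr1; ring.
have -> : k.+2%:R * x = k.+1%:R * x + x by rewrite -[k.+2%:R]natr1; ring.
by rewrite sinB sinD; ring.
Qed.

Lemma half_turn_ex (R : realType) m : (1 < m)%N -> exists a : R, half_turn a m.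
Proof.
move=> m1; have mR : (0 : R) < m%:R by rewrite ltr0n; lia.
pose x : R := trigo.pi / m%:R; have pi0 := pi_gt0 R.
have mx : m%:R * x = trigo.pi by rewrite /x mulrC divfK // lt0r_neq0.
have x0 : 0 < x by rewrite divr_gt0.
have sx k : (0 < k < m)%N -> 0 < sin (k%:R * x).
  move=> /andP[k0 km]; apply: sin_gt0_pi.
  by rewrite mulr_gt0 ?ltr0n //= -mx ltr_pM2r // ltr_nat.
have s0 : 0 < sin x by have := sx 1%N; rewrite m1 mul1r => /(_ isT).
exists (2 * cos x); split; first by lia.
  by apply: (mulIf (lt0r_neq0 s0)); rewrite cheb_cos mx sinpi mul0r.
by move=> k /sx; rewrite -cheb_cos pmulr_lgt0.
Qed.

(** * Perron-Frobenius for symmetric matrices *)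

Lemma continuous_bigsum (R : realType) (T : topologicalType) (I : Type)
    (r : seq I) (f : I -> T -> R) :
  (forall i, continuous (f i)) -> continuous (fun v => \sum_(i <- r) f i v).
Proof.
move=> cf; elim: r => [|i r IH] v.
  rewrite (_ : (fun _ => _) = fun=> 0); first exact: cst_continuous.
  by apply/funext => w; rewrite big_nil.
rewrite (_ : (fun _ => _) = f i \+ (fun v => \sum_(i <- r) f i v)).
  by apply: continuousD; [exact: cf | exact: IH].
by apply/funext => w; rewrite big_cons.
Qed.

Section Perron.
Variables (R : realType) (n : nat) (A : 'I_n -> 'I_n -> R).
Hypotheses (A_sym : forall i j, A i j = A j i) (A_ge0 : forall i j, 0 <= A i j).
Hypothesis A_conn : forall i j, connect [rel i j | 0 < A i j] i j.

Let N (v : 'I_n -> R) := \sum_i v i * v i.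
Let q (v : 'I_n -> R) := \sum_i \sum_j A i j * (v i * v j).
Let f (v : 'rV[R]_n) : 'I_n -> R := fun i => v ord0 i.

(** The continuous form [q] attains its maximum on the unit sphere, a closed part of a compact cube;
    homogeneity carries the bound to all vectors. *)
Lemma perron_max (i0 : 'I_n) : exists2 c, N c = 1 & forall y, q y <= q c * N y.
Proof.
have cc i : continuous (fun v : 'rV[R]_n => v ord0 i) by apply: coord_continuous.
have cN : continuous (fun v => N (f v)).
  by apply: continuous_bigsum => i v; exact: (continuousM (cc i v) (cc i v)).
have cq : continuous (fun v => q (f v)).
  apply: continuous_bigsum => i; apply: continuous_bigsum => j v.
  exact: (continuousM (@cst_continuous _ _ (A i j) v) (continuousM (cc i v) (cc j v))).
pose B := [set v | N (f v) = 1]%classic.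
have cB : compact B.
  apply: (@subclosed_compact _ _ [set v : 'rV[R]_n | forall i, `[-1, 1]%classic (v ord0 i)]%classic).
  - have H := @preimage_closed _ _ (fun v : 'rV[R]_n => N (f v)) [set z | z = 1]%classic.
    by apply: H; [move=> v _; exact: cN | exact: closed_eq].
  - have H := @rV_compact R n (fun=> `[-1, 1]%classic) (fun=> @segment_compact R _ _).
    exact: H.
  move=> v /= Nv i; rewrite /= in_itv /=.
  have : v ord0 i * v ord0 i <= 1.
    rewrite -Nv /N (bigD1 i) //= lerDl; apply: sumr_ge0 => j _.
    by rewrite -expr2 sqr_ge0.
  by move=> H; apply/andP; split; nra.
have B0 : (B !=set0)%classic.
  exists (delta_mx 0 i0); rewrite /B /= /N (bigD1 i0) //= big1 => [|j ji].
    by rewrite /f mxE !eqxx mulr1 addr0.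
  by rewrite /f mxE (negPf ji) andbF mulr0.
have [c cB1 cmax] := EVT_max_rV B0 cB (continuous_subspaceT cq).
move/set_mem in cB1.
exists (f c) => // y.
have Ny0 : 0 <= N y by apply: sumr_ge0 => i _; rewrite -expr2 sqr_ge0.
have [Ny|Ny] := eqVneq (N y) 0.
  have y0 i : y i = 0.
    apply/eqP; have : y i * y i == 0.
      move/eqP: Ny; rewrite psumr_eq0; last by move=> j _; rewrite -expr2 sqr_ge0.
      by move=> /allP /(_ i (mem_index_enum _)).
    by rewrite mulf_eq0 orbb.
  rewrite Ny mulr0 /q big1 // => i _; rewrite big1 // => j _.
  by rewrite y0 mul0r mulr0.
have Ny1 : 0 < N y by rewrite lt0r Ny.
pose s := Num.sqrt (N y).
have s0 : 0 < s by rewrite sqrtr_gt0.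
have s2 : s * s = N y by rewrite -expr2 sqr_sqrtr.
have s1 : s != 0 by rewrite lt0r_neq0.
have yE i : y i = s * f (\row_i (y i / s)) i.
  by rewrite /f mxE mulrC divfK.
set z := \row_i (y i / s) in yE.
have Nz : N (f z) = 1.
  have : N y = s * s * N (f z).
    by rewrite /N mulr_sumr; apply: eq_bigr => i _; rewrite yE; ring.
  rewrite s2 => E; apply: (mulfI Ny); rewrite mulr1; exact/esym.
have qz : q y = N y * q (f z).
  rewrite -s2 /q mulr_sumr; apply: eq_bigr => i _; rewrite mulr_sumr.
  by apply: eq_bigr => j _; rewrite !(yE i) !(yE j); ring.
rewrite qz mulrC ler_pM2r //; by apply/cmax/mem_set.
Qed.

(* The entrywise absolute value of a maximiser of the quadratic form on the
   sphere is again a maximiser, hence an eigenvector. *)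
Theorem perron_frobenius (i0 : 'I_n) : exists (x : 'I_n -> R) (la : R),
  (forall i, 0 < x i) /\ forall i, \sum_j A i j * x j = la * x i.
Proof.
have [c Nc qc] := perron_max i0.
set la := q c in qc; pose x i : R := `|c i|.
have Nx : N x = 1.
  by rewrite -Nc; apply: eq_bigr => i _; rewrite /x -normrM ger0_norm // -expr2 sqr_ge0.
have qx : q x = la.
  apply/eqP; rewrite eq_le; apply/andP; split; first by rewrite -[la]mulr1 -Nx.
  apply: ler_sum => i _; apply: ler_sum => j _; apply: ler_wpM2l => //.
  by rewrite /x -normrM ler_norm.
have x0 i : 0 <= x i by exact: normr_ge0.
have eig i : \sum_j A i j * x j = la * x i.
  set b := la * x i; set s := \sum_j _.
  (* First variation: moving [x] by [t] in direction [i] respects the bound of [qc], and the linear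
     term in [t] measures the defect of the eigenvalue equation. *)
  have H (t : R) : 0 <= 2 * t * (b - s) + t ^+ 2 * (la - A i i).
    pose y j : R := x j + t * (j == i)%:R.
    have dl (F : 'I_n -> R) : \sum_j (j == i)%:R * F j = F i.
      rewrite (bigD1 i) //= eqxx mul1r big1 ?addr0 // => j /negPf ->.
      by rewrite mul0r.
    have Ny : N y = 1 + 2 * t * x i + t ^+ 2.
      have E : 2 * t * x i + t ^+ 2 = \sum_j (j == i)%:R * (2 * t * x j + t ^+ 2 * (j == i)%:R).
        by rewrite dl eqxx mulr1.
      rewrite -addrA E; transitivity (N x + \sum_j (j == i)%:R * (2 * t * x j + t ^+ 2 * (j == i)%:R)).
        by rewrite /N -big_split /=; apply: eq_bigr => j _; rewrite /y; ring.
      by rewrite Nx.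
    have qy : q y = la + 2 * t * s + t ^+ 2 * A i i.
      have -> : q y = q x + t * \sum_j \sum_k A j k * ((j == i)%:R * x k)
          + t * \sum_j \sum_k A j k * (x j * (k == i)%:R)
          + t ^+ 2 * \sum_j \sum_k A j k * ((j == i)%:R * (k == i)%:R).
        rewrite /q !mulr_sumr -!big_split /=; apply: eq_bigr => j _.
        rewrite !mulr_sumr -!big_split /=; apply: eq_bigr => k _.
        by rewrite /y; ring.
      have -> : \sum_j \sum_k A j k * ((j == i)%:R * x k) = s.
        rewrite /s -(dl (fun j => \sum_k A j k * x k)); apply: eq_bigr => j _.
        by rewrite mulr_sumr; apply: eq_bigr => k _; ring.
      have -> : \sum_j \sum_k A j k * (x j * (k == i)%:R) = s.
        apply: eq_bigr => j _; rewrite -(dl (fun k => A i j * x j)) //.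
        by apply: eq_bigr => k _; case: eqVneq => [->|_] /=; rewrite ?(A_sym j i); ring.
      have -> : \sum_j \sum_k A j k * ((j == i)%:R * (k == i)%:R) = A i i.
        rewrite -(dl (fun j => A j i)); apply: eq_bigr => j _.
        rewrite -(dl (fun k => A j k)) mulr_sumr.
        by apply: eq_bigr => k _; ring.
      by rewrite qx; ring.
    have := qc y; rewrite Ny qy /b; lra.
  apply/eqP; rewrite -subr_eq0; apply/negPn/negP => sb.
  (* The step [(s - b) * u] is short enough for the linear term to outweigh the quadratic one, which
     makes the expression in [H] negative. *)
  set d := la - A i i in H; pose u := (1 + `|d|)^-1.
  have u0 : 0 < u by rewrite invr_gt0 ltr_wpDr.
  have ud : u * d < 1.
    have uE : u * (1 + `|d|) = 1 by rewrite mulVf // lt0r_neq0 // ltr_wpDr.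
    by have := ler_norm d; nra.
  have sb2 : 0 < (s - b) ^+ 2 by rewrite exprn_even_gt0.
  have := H ((s - b) * u).
  have -> : 2 * ((s - b) * u) * (b - s) + ((s - b) * u) ^+ 2 * d
     = - ((s - b) ^+ 2 * (u * (2 - u * d))) by ring.
  by rewrite oppr_ge0 leNgt mulr_gt0 // mulr_gt0 //; lra.
exists x, la; split=> // i.
rewrite lt0r x0 andbT; apply/negP => xi.
(* At a zero entry of [x] a sum of nonnegative terms vanishes, so the zero spreads along the edges
   and, by connectedness, everywhere. *)
have prop j k : x j == 0 -> 0 < A j k -> x k == 0.
  move=> /eqP xj Ajk; have /eqP := eig j; rewrite xj mulr0 psumr_eq0.
    move=> /allP /(_ k (mem_index_enum _)) /=.
    by rewrite mulf_eq0 (gt_eqF Ajk).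
  by move=> l _; rewrite mulr_ge0.
have all0 j : x j = 0.
  apply/eqP; have /connectP[p pth ->] := A_conn i j.
  elim: p i xi pth => //= k p IH l xl /andP[Alk].
  by apply: IH; apply: prop xl Alk.
by move/eqP: Nx; rewrite /N big1 ?(eq_sym 0) ?oner_eq0 // => j _; rewrite all0 mul0r.
Qed.
End Perron.

(** * Words with one letter per vertex of a forest *)

Section Forest.
Local Open Scope nat_scope.
Variables (T : finType) (nb : rel T).
Hypothesis nb_sym : symmetric nb.
(** Acyclicity in the form that suits inductions removing one vertex at a time. *)
Hypothesis leafP : forall J : {set T}, J != set0 ->
  exists2 i, i \in J & #|[set j in J | nb i j]| <= 1.
Implicit Types (x y : T) (u v w : seq T).

(** Colour the set without a leaf first; the leaf then takes the colour opposite to that of its only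
    possible neighbour. *)
Lemma forest_coloring :
  irreflexive nb -> exists col : T -> bool, forall x y, nb x y -> col x != col y.
Proof.
move=> nbI.
suff [col H] : exists col : T -> bool,
    {in setT &, forall x y, nb x y -> col x != col y}.
  by exists col => x y; apply: H; rewrite inE.
have [N] := ubnP #|[set: T]|; elim: N setT => // N IH J; rewrite ltnS => JN.
have [->|J0] := eqVneq J set0; first by exists xpredT => x y; rewrite inE.
have [i iJ leaf] := leafP J0.
have [|col H] := IH (J :\ i); first by rewrite (cardsD1 i J) iJ in JN.
pose c := if [pick j in J | nb i j] is Some j then ~~ col j else true.
have cP y : y \in J -> nb i y -> c != col y.
  move=> yJ iy; rewrite /c; case: pickP => [j /andP[jJ ij]|/(_ y)]; last by rewrite yJ iy.
  have /card_le1P/(_ j) E := leaf.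
  have : y \in [set j in J | nb i j] by rewrite inE yJ iy.
  rewrite E ?inE ?jJ // => /eqP ->.
  by case: (col j).
exists (fun x => if x == i then c else col x) => x y xJ yJ.
case: (eqVneq x i) => [->|xi]; case: (eqVneq y i) => [->|yi].
- by rewrite nbI.
- exact: cP.
- by rewrite nb_sym eq_sym; apply: cP.
- by apply: H; rewrite !inE ?xi ?yi.
Qed.

(** When letters not joined by [nb] commute, these moves preserve the conjugacy class of the
    product. *)
Inductive cox_move : seq T -> seq T -> Prop :=
| MoveRefl u : cox_move u u
| MoveSym u v : cox_move u v -> cox_move v u
| MoveTrans u v w : cox_move u v -> cox_move v w -> cox_move u w
| MoveSwap u x y v : ~~ nb x y -> cox_move (u ++ x :: y :: v) (u ++ y :: x :: v)
| MoveRot x u : cox_move (x :: u) (rcons u x).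

Lemma cox_move_perm u v : cox_move u v -> perm_eq u v.
Proof.
elim=> {u v} [//|u v _|u v w _ + _|u x y v _|x u]; rewrite ?(perm_sym v u) //.
- by move=> /perm_trans H /H.
- by rewrite perm_cat2l -[x :: y :: v]/([:: x] ++ [:: y] ++ v) perm_catCA.
- by rewrite perm_sym perm_rcons.
Qed.

Lemma cox_move_slide v i u : all (predC (nb i)) u ->
  cox_move (v ++ rcons u i) (v ++ i :: u).
Proof.
elim: u v => [|y u IH] v /=; first by move=> _; apply: MoveRefl.
move=> /andP[iy /IH H]; apply: (@MoveTrans _ (v ++ y :: i :: u)).
  by have := H (rcons v y); rewrite !cat_rcons.
by apply: MoveSwap; rewrite nb_sym.
Qed.

(* A rotation of u is simulated on i :: u by sliding i around the circle past
   the letters it commutes with, in the direction that avoids its neighbour. *)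
Lemma cox_move_cons i u v : cox_move u v -> count (nb i) u <= 1 ->
  cox_move (i :: u) (i :: v).
Proof.
elim=> {u v} [u|u v uv IH|u v w uv IH1 _ IH2|u x y v xy|x u].
- by move=> _; apply: MoveRefl.
- have /seq.permP E := cox_move_perm uv.
  by rewrite -E => /IH; apply: MoveSym.
- have /seq.permP E := cox_move_perm uv.
  by move=> cu; apply: MoveTrans (IH1 cu) (IH2 _); rewrite -E.
- by move=> _; rewrite -!cat_cons; apply: MoveSwap.
rewrite /=; case: (boolP (nb i x)) => ix /= cu.
  have iu : all (predC (nb i)) u.
    by rewrite all_predC has_count -leqNgt -(leq_add2l 1) addn0.
  apply: MoveTrans (MoveRot _ _) _.
  apply: (@MoveTrans _ (x :: i :: u)).
    exact: (cox_move_slide [:: x] iu).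
  exact: MoveRot.
apply: (@MoveTrans _ (x :: i :: u)); first exact: (MoveSwap [::]).
exact: MoveRot.
Qed.

Lemma cox_move_rot u v : cox_move (u ++ v) (v ++ u).
Proof.
elim: u v => [|x u IH] v; first by rewrite cats0; apply: MoveRefl.
apply: MoveTrans (MoveRot _ _) _.
by rewrite rcons_cat -cat_rcons; apply: IH.
Qed.

(** Induction on the number of letters: a leaf of the letter set is rotated to the front of both
    words, and the moves between the remaining words lift by [cox_move_cons]. *)
Lemma cox_move_perm_eq u v : uniq u -> perm_eq u v -> cox_move u v.
Proof.
have [N] := ubnP (size u); elim: N u v => // N IH u v; rewrite ltnS => uN uu uv.
case: u uN uu uv => [|x0 u0] uN uu uv.
  by rewrite perm_sym in uv; rewrite (perm_nilP uv); apply: MoveRefl.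
set u := x0 :: u0 in uN uu uv *.
have [|i] := @leafP [set x in u].
  by apply/set0Pn; exists x0; rewrite inE mem_head.
rewrite inE => iu leaf.
have cu : count (nb i) u <= 1.
  rewrite -size_filter -(card_uniqP (filter_uniq _ uu)) -cardsE.
  apply: leq_trans leaf; apply: subset_leq_card; apply/subsetP => x.
  by rewrite !inE mem_filter andbC.
have iv : i \in v by rewrite -(perm_mem uv).
have front w : i \in w -> exists2 w', cox_move w (i :: w') & perm_eq w (i :: w').
  move=> /splitPr[p1 p2]; have M := cox_move_rot p1 (i :: p2).
  by exists (p2 ++ p1); rewrite ?(cox_move_perm M).
have [u' Mu Pu] := front _ iu; have [v' Mv Pv] := front _ iv.
apply: MoveTrans Mu _; apply: MoveTrans (MoveSym Mv).
have P' : perm_eq u' v'.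
  by rewrite -(perm_cons i) -(permPl Pu) (permPl uv).
have cu' : count (nb i) u' <= 1.
  by move: cu; rewrite (seq.permP Pu) /=; lia.
apply: cox_move_cons cu'; apply: IH P'.
  by have := perm_size Pu; rewrite /= => [[<-]]; rewrite -ltnS; apply: leq_ltn_trans uN _; rewrite ltnS.
by move: uu; rewrite (perm_uniq Pu) /= => /andP[].
Qed.

End Forest.

Section MoveConj.
Variables (gT : finGroupType) (I : finType) (gen : I -> gT) (nb : rel I).
Hypothesis nbC : forall i j, ~~ nb i j -> commute (gen i) (gen j).
Local Open Scope group_scope.

(** The conjugator is built from letters of the word, hence stays in [H]; this later confines
    conjugation to a parabolic subgroup. *)
Lemma cox_move_conj (u v : seq I) (H : {group gT}) :
  (forall i, i \in u -> gen i \in H) -> cox_move nb u v ->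
  exists2 g, g \in H & \prod_(i <- v) gen i = (\prod_(i <- u) gen i) ^ g.
Proof.
move=> uH M; elim: M uH => {u v} [u|u v uv IH|u v w uv IH1 _ IH2|u i j v ij|i u] uH.
- by exists 1; rewrite ?conjg1.
- have [|g gH ->] := IH; first by move=> i; rewrite (perm_mem (cox_move_perm uv)); apply: uH.
  by exists g^-1; rewrite ?groupV // conjgK.
- have [|g gH E] := IH1; first by [].
  have [|k kH ->] := IH2; first by move=> i; rewrite -(perm_mem (cox_move_perm uv)); apply: uH.
  by exists (g * k); rewrite ?groupM // E conjgM.
- exists 1 => //; rewrite conjg1 !big_cat !big_cons /= !(mulgA (gen i)) !(mulgA (gen j)).
  by rewrite (nbC ij).
exists (gen i); first by apply: uH; rewrite mem_head.
by rewrite big_cons -cats1 big_cat big_seq1 conjgE !mulgA mulVg mul1g.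
Qed.
End MoveConj.

(** * The geometric representation *)

Fixpoint alt (T : Type) (x y : T) k : seq T :=
  if k is k'.+1 then x :: alt y x k' else [::].

Lemma alt_rcons T (x y : T) k :
  alt x y k.+1 = rcons (alt x y k) (if odd k then y else x).
Proof.
by elim: k x y => [|k IH] x y //; rewrite -[LHS]/(x :: alt y x k.+1) IH /=; case: (odd k).
Qed.

Lemma size_alt T (x y : T) k : size (alt x y k) = k.
Proof. by elim: k x y => [|k IH] x y //=; rewrite IH. Qed.

Section GeometricMatrices.
Variables (R : realFieldType) (n : nat) (a : 'I_n -> 'I_n -> R).
Hypothesis a_sym : forall i j, a i j = a j i.
Implicit Types (i j k : 'I_n) (x y : 'rV[R]_n) (u v : seq 'I_n).

(* Rows are vectors written in the simple roots, on which W acts on the right;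
   columns are linear forms, on which it acts on the left.  When
   a i j = 2 cos(pi / m(i, j)), [gram] is twice the usual Gram matrix. *)
Definition gram : 'M[R]_n := \matrix_(i, j) (if i == j then 2 else - a i j).
Local Notation G := gram.
Local Notation e i := (delta_mx 0 i : 'rV[R]_n).

Definition sig i : 'M[R]_n := 1%:M - col i G *m e i.
Definition mprod u : 'M[R]_n := \prod_(i <- u) sig i.

Lemma mprod_nil : mprod [::] = 1%:M. Proof. by rewrite /mprod big_nil. Qed.
Lemma mprod_cons i u : mprod (i :: u) = sig i *m mprod u.
Proof. by rewrite /mprod big_cons. Qed.
Lemma mprod_cat u v : mprod (u ++ v) = mprod u *m mprod v.
Proof. by rewrite /mprod big_cat. Qed.
Lemma mprod_rcons u i : mprod (rcons u i) = mprod u *m sig i.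
Proof. by rewrite -cats1 mprod_cat mprod_cons mprod_nil mulmx1. Qed.

Lemma act_sig x i : x *m sig i = x - (x *m G) 0 i *: e i.
Proof.
rewrite mulmxBr mulmx1 mulmxA; congr (_ - _).
by rewrite colE mulmxA -colE [col i _]mx11_scalar mul_scalar_mx !mxE.
Qed.

Lemma eG i j : (e i *m G) 0 j = if i == j then 2 else - a i j.
Proof. by rewrite -rowE !mxE. Qed.

Lemma eGii i : (e i *m G) 0 i = 2. Proof. by rewrite eG eqxx. Qed.

Lemma pair_sig x i j :
  ((x *m sig i) *m G) 0 j = (x *m G) 0 j - (x *m G) 0 i * (e i *m G) 0 j.
Proof. by rewrite act_sig mulmxBl -scalemxAl [LHS]mxE [X in _ + X]mxE [X in - X]mxE. Qed.

Lemma e_sig i : e i *m sig i = - e i.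
Proof. by rewrite act_sig eGii scaler_nat mulr2n opprD addrA subrr add0r. Qed.

Lemma e_sig_neq i j : i != j -> e i *m sig j = e i + a i j *: e j.
Proof. by move=> ij; rewrite act_sig eG (negPf ij) scaleNr opprK. Qed.

Lemma sig_sq i : sig i *m sig i = 1%:M.
Proof.
apply/row_matrixP => k; rewrite !rowE mulmx1 mulmxA.
by rewrite [e k *m _]act_sig mulmxBl -scalemxAl e_sig act_sig scalerN opprK subrK.
Qed.

Lemma sig_coord x i j : j != i -> (x *m sig i) 0 j = x 0 j.
Proof.
by move=> ji; rewrite act_sig !mxE (negPf ji) /= mulr0 subr0.
Qed.

Lemma mprod_coord x u j : j \notin u -> (x *m mprod u) 0 j = x 0 j.
Proof.
elim: u x => [|i u IH] x; first by rewrite mprod_nil mulmx1.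
rewrite inE negb_or => /andP[ji ju]; rewrite mprod_cons mulmxA IH //.
exact: sig_coord.
Qed.

(* The coefficients subtracted from x by the successive letters of s_i s_j s_i ... *)
Definition alt_coef i j (xi eta : R) (l : nat) :=
  xi * cheb (a i j) l.+1 + eta * cheb (a i j) l.

Lemma alt_coef_rec i j xi eta : chebrec (a i j) (alt_coef i j xi eta).
Proof. by move=> l; rewrite /alt_coef !chebSS; ring. Qed.

(** After the first letter the two pairings start the same sequence [alt_coef] one index later, with
    [i] and [j] exchanged. *)
Lemma alt_act i j (k : nat) x : i != j ->
  x *m mprod (alt i j k) = x
   - (\sum_(l < k | ~~ odd l) alt_coef i j ((x *m G) 0 i) ((x *m G) 0 j) l) *: e i
   - (\sum_(l < k | odd l) alt_coef i j ((x *m G) 0 i) ((x *m G) 0 j) l) *: e j.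
Proof.
elim: k i j x => [|k IH] i j x ij.
  by rewrite mprod_nil mulmx1 !big_ord0 !scale0r !subr0.
have ji : j != i by rewrite eq_sym.
rewrite mprod_cons mulmxA IH // !pair_sig eG (negPf ij) eGii.
set xi := (x *m G) 0 i; set eta := (x *m G) 0 j.
have E l : alt_coef j i (eta - xi * - a i j) (xi - xi * 2) l = alt_coef i j xi eta l.+1.
  by rewrite /alt_coef (a_sym j i) chebSS; ring.
have ES (P : pred nat) :
    \sum_(l < k | P l) alt_coef j i (eta - xi * - a i j) (xi - xi * 2) l =
    \sum_(l < k | P l) alt_coef i j xi eta l.+1.
  by apply: eq_bigr => l _; rewrite E.
have SH (P : pred nat) (f : nat -> R) :
    \sum_(l < k.+1 | P l) f l = (if P 0%N then f 0%N else 0) + \sum_(l < k | P l.+1) f l.+1.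
  by rewrite big_mkcond big_ord_recl -big_mkcond.
rewrite (ES (fun l => ~~ odd l)) (ES odd) act_sig -/xi.
rewrite (SH (fun l => ~~ odd l)) (SH odd) /=.
rewrite {3}/alt_coef cheb1 cheb0 mulr1 mulr0 addr0 add0r.
rewrite [X in _ - (_ + X) *: _](eq_bigl (fun l : 'I_k => odd l)); last by move=> l; rewrite negbK.
by rewrite scalerDl opprD !addrA [LHS]addrAC.
Qed.

(** The power is an alternating word with 2m letters. It subtracts the even- and odd-indexed sums of
    a Chebyshev solution, and [chebrec_sum_even] makes both vanish. *)
Lemma braid_mx i j m : i != j -> half_turn (a i j) m ->
  (sig i * sig j) ^+ m = 1.
Proof.
move=> ij Hm.
have -> : (sig i * sig j) ^+ m = mprod (alt i j m.*2).
  elim: m {Hm} => [|m IH]; first by rewrite mprod_nil.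
  by rewrite exprS IH doubleS /= !mprod_cons mulmxA.
apply/row_matrixP => k; rewrite !rowE mulmx1 alt_act //.
set xi := _ 0 i; set eta := _ 0 j.
have H := alt_coef_rec i j xi eta.
have S0 := chebrec_sum_even Hm H.
have S1 := chebrec_sum_even Hm (chebrec_shift 1 H).
have D (f : nat -> R) (P : pred nat) q : \sum_(l < q.*2 | P l) f l
   = \sum_(l < q | P l.*2) f l.*2 + \sum_(l < q | P l.*2.+1) f l.*2.+1.
  elim: q => [|q IH]; first by rewrite !big_ord0 addr0.
  rewrite doubleS 2!big_mkcond 2!big_ord_recr -big_mkcond /= IH.
  rewrite [in RHS]big_mkcond [X in _ = X + _]big_ord_recr -big_mkcond /=.
  rewrite [X in _ = _ + X]big_mkcond [X in _ = _ + X]big_ord_recr -big_mkcond /=.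
  ring.
rewrite (D _ (fun l => ~~ odd l)) (D _ odd).
rewrite (eq_bigl predT); last by move=> l /=; rewrite odd_double.
rewrite S0 big_pred0; last by move=> l /=; rewrite odd_double.
rewrite big_pred0; last by move=> l /=; rewrite odd_double.
rewrite (eq_bigl predT); last by move=> l /=; rewrite odd_double.
by rewrite S1 !addr0 !scale0r !subr0.
Qed.

(** These are roots of the dihedral group on [i] and [j]; for [k] below the order of the product
    their coefficients are nonnegative. *)
Lemma e_alt i j (k : nat) : i != j ->
  e i *m mprod (alt j i k) =
    cheb (a i j) (k + ~~ odd k) *: e i + cheb (a i j) (k + odd k) *: e j.
Proof.
move=> ij; have ji : j != i by rewrite eq_sym.
elim: k => [|k IH].
  rewrite mprod_nil mulmx1 -[cheb _ (0 + ~~ _)]/(1 : R).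
  by rewrite -[cheb _ (0 + odd _)]/(0 : R) scale0r scale1r addr0.
rewrite alt_rcons mprod_rcons mulmxA IH mulmxDl -!scalemxAl.
rewrite [odd k.+1]/=; case: (odd k); rewrite !(addn1, addn0) chebSS e_sig e_sig_neq //; apply/rowP => l;
  rewrite !mxE ?(a_sym j i); ring.
Qed.

End GeometricMatrices.

(** * Words in the generators and word length *)

Lemma wprod_nil (gT : finGroupType) : wprod [::] = 1%g :> gT.
Proof. by rewrite /wprod big_nil. Qed.
Lemma wprod_cons (gT : finGroupType) (x : gT) u : wprod (x :: u) = (x * wprod u)%g.
Proof. by rewrite /wprod big_cons. Qed.
Lemma wprod_cat (gT : finGroupType) (u v : seq gT) :
  wprod (u ++ v) = (wprod u * wprod v)%g.
Proof. by rewrite /wprod big_cat. Qed.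

Section Words.
Variables (gT : finGroupType) (n : nat) (gen : 'I_n -> gT).
Hypothesis gen_ord : forall i, #[gen i]%g = 2%N.
Implicit Types (i j : 'I_n) (u v y : seq 'I_n).

Definition gprod u : gT := wprod (map gen u).

Lemma gprod_nil : gprod [::] = 1%g. Proof. exact: wprod_nil. Qed.
Lemma gprod_cons i u : gprod (i :: u) = (gen i * gprod u)%g.
Proof. exact: wprod_cons. Qed.
Lemma gprod_cat u v : gprod (u ++ v) = (gprod u * gprod v)%g.
Proof. by rewrite /gprod map_cat wprod_cat. Qed.
Lemma gprod1 i : gprod [:: i] = gen i.
Proof. by rewrite gprod_cons gprod_nil mulg1. Qed.

Lemma gen_sq i : (gen i * gen i = 1)%g.
Proof. by rewrite -expg2 -(gen_ord i) expg_order. Qed.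

Lemma gen_inv i : ((gen i)^-1 = gen i)%g.
Proof. by apply/eqP; rewrite eq_invg_mul gen_sq. Qed.

Lemma gprod_consK i u : gprod (i :: i :: u) = gprod u.
Proof. by rewrite !gprod_cons mulgA gen_sq mul1g. Qed.

Lemma gprod_rev u : gprod (rev u) = ((gprod u)^-1)%g.
Proof.
elim: u => [|i u IH]; first by rewrite gprod_nil invg1.
by rewrite rev_cons -cats1 gprod_cat gprod1 gprod_cons invMg gen_inv IH.
Qed.

Lemma gprod_conj u i : gprod (rev u ++ i :: u) = ((gen i) ^ (gprod u))%g.
Proof. by rewrite gprod_cat gprod_cons gprod_rev conjgE mulgA. Qed.

Lemma gprod_alt_comm i j k :
  gprod (alt i j k) = ((gen i * gen j) ^+ k * gprod (alt j i k))%g.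
Proof.
elim: k => [|k IH]; first by rewrite expg0 mul1g.
rewrite -[alt i j k.+1]/(i :: alt j i k) -[alt j i k.+1]/(j :: alt i j k).
rewrite !gprod_cons [in RHS]IH expgSr -!mulgA (mulgA (gen j) (gen j)) gen_sq mul1g.
rewrite !mulgA; congr (_ * _)%g.
elim: k {IH} => [|k IH]; first by rewrite !expg0 mul1g mulg1.
rewrite {1}expgSr expgS -!mulgA (mulgA (gen i) (gen i)) gen_sq mul1g.
by rewrite (mulgA (gen j)) gen_sq mul1g !mulgA.
Qed.

Lemma gprod_braid i j m : #[gen i * gen j]%g = m ->
  gprod (alt i j m) = gprod (alt j i m).
Proof. by move=> <-; rewrite gprod_alt_comm expg_order mul1g. Qed.

Lemma gprod_genP (J : {set 'I_n}) w :
  reflect (exists2 u, all (mem J) u & gprod u = w) (w \in <<gen @: J>>%g).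
Proof.
apply: (iffP idP) => [|[u uJ <-]]; last first.
  elim: u uJ => [|i u IH] /=; first by rewrite gprod_nil group1.
  by move=> /andP[iJ /IH H]; rewrite gprod_cons groupM // mem_gen // imset_f.
move=> /gen_prodgP[k [c cJ ->]].
elim: k c cJ => [|k IH] c cJ.
  by exists [::] => //; rewrite gprod_nil big_ord0.
have [u uJ E] := IH (fun l => c (lift ord0 l)) (fun l => cJ _).
have /imsetP[i iJ ci] := cJ ord0.
by exists (i :: u); [rewrite /= iJ | rewrite gprod_cons big_ord_recl ci E].
Qed.

(** The implication makes [len] total: an element outside the generated subgroup gets length 0. *)
Definition has_len (w : gT) k :=
  `[< (exists u, gprod u = w) -> exists2 u, gprod u = w & size u = k >].

Lemma has_len_ex w : exists k, has_len w k.
Proof.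
case: (pselect (exists u, gprod u = w)) => [[u uw]|nw].
  by exists (size u); apply/asboolP => _; exists u.
by exists 0%N; apply/asboolP => /nw.
Qed.

Definition len w := ex_minn (has_len_ex w).

Lemma len_le u : (len (gprod u) <= size u)%N.
Proof.
rewrite /len; case: ex_minnP => k _; apply.
by apply/asboolP => _; exists u.
Qed.

Lemma len_ex u : exists2 v, gprod v = gprod u & size v = len (gprod u).
Proof.
by rewrite /len; case: ex_minnP => k /asboolP + _; apply; exists u.
Qed.

Lemma len_cat u v : (len (gprod (u ++ v)) <= size u + len (gprod v))%N.
Proof.
have [y E <-] := len_ex v.
by rewrite gprod_cat -E -gprod_cat -size_cat len_le.
Qed.

End Words.

(** * Positivity of roots, faithfulness and parabolic subgroups *)

Definition nneg (R : realFieldType) n (x : 'rV[R]_n) := forall l, 0 <= x 0 l.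

Lemma nneg_anti (R : realFieldType) n (x : 'rV[R]_n) : nneg x -> nneg (- x) -> x = 0.
Proof.
move=> p q; apply/rowP => l; rewrite mxE; apply/eqP; rewrite eq_le p andbT.
by have := q l; rewrite mxE oppr_ge0.
Qed.

(** The numbers [a i j] play the role of 2 cos(pi/m(i, j)); recording only their half-turn property
    lets the algebra run over any ordered field. *)
Record coxeter_rep (gT : finGroupType) n (gen : 'I_n -> gT) (R : realFieldType)
    (a : 'I_n -> 'I_n -> R) : Prop := CoxeterRep {
  cr_inj : injective gen;
  cr_ord : forall i, #[gen i]%g = 2%N;
  cr_sym : forall i j, a i j = a j i;
  cr_half : forall i j, i != j -> half_turn (a i j) #[gen i * gen j]%g;
  cr_pres : forall u v : seq 'I_n, gprod gen u = gprod gen v ->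
    coxeter_congr (gen @: setT) (map gen u) (map gen v) }.

Section Representation.
Variables (gT : finGroupType) (n : nat) (gen : 'I_n -> gT) (R : realFieldType)
  (a : 'I_n -> 'I_n -> R).
Hypothesis Hrep : coxeter_rep gen a.
Implicit Types (i j : 'I_n) (u v y : seq 'I_n) (x : 'rV[R]_n).
Local Notation G := (gram a).
Local Notation e i := (delta_mx 0 i : 'rV[R]_n).
Local Notation gprod := (gprod gen).
Local Notation len := (len gen).
Local Notation sig := (sig a).
Local Notation mprod := (mprod a).
Let gen_ord := cr_ord Hrep.
Let a_sym := cr_sym Hrep.

Definition sigT (s : gT) : 'M[R]_n :=
  if [pick i | gen i == s] is Some i then sig i else 1%:M.

Lemma sigT_gen i : sigT (gen i) = sig i.
Proof.
rewrite /sigT; case: pickP => [j /eqP /(cr_inj Hrep) -> //|/(_ i)].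
by rewrite eqxx.
Qed.

Lemma congr_mx (S : {set gT}) (w w' : seq gT) : S = gen @: setT ->
  coxeter_congr S w w' -> \prod_(s <- w) sigT s = \prod_(s <- w') sigT s.
Proof.
move=> SE; elim=> {w w'} [//|//|u v w _ -> _ -> //|u v s t].
rewrite SE => /imsetP[i _ ->] /imsetP[j _ ->].
rewrite !big_cat /=; congr (_ * _); rewrite -[RHS]mul1r; congr (_ * _).
transitivity ((sig i * sig j) ^+ #[gen i * gen j]%g).
  elim: #[_]%g => [|k IH]; first by rewrite big_nil.
  by rewrite /= !big_cons IH !sigT_gen exprS mulrA.
have [->|ij] := eqVneq i j; last exact: braid_mx (cr_half Hrep ij).
by rewrite (gen_sq gen_ord) order1 expr1; apply: sig_sq.
Qed.

(** The defining relations hold for the matrices, so the presentation makes the matrix depend on the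
    group element only. *)
Lemma mprod_gprod u v : gprod u = gprod v -> mprod u = mprod v.
Proof.
have E w : \prod_(s <- map gen w) sigT s = mprod w.
  by rewrite big_map; apply: eq_bigr => i _; rewrite sigT_gen.
by move=> /(cr_pres Hrep) /(congr_mx erefl); rewrite !E.
Qed.

Lemma mprod_revl u : mprod (rev u) *m mprod u = 1%:M.
Proof.
rewrite -mprod_cat -(mprod_nil a); apply: mprod_gprod.
by rewrite gprod_cat gprod_rev // mulVg gprod_nil.
Qed.

Lemma mprod_revr u : mprod u *m mprod (rev u) = 1%:M.
Proof. by rewrite -{1}(revK u) mprod_revl. Qed.

Lemma alt_add (T : Type) (z t : T) k l :
  exists w, size w = l /\ alt z t (k + l) = alt z t k ++ w.
Proof.
elim: k z t => [|k IH] z t; first by exists (alt z t l); rewrite size_alt.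
by have [w [sw E]] := IH t z; exists w; rewrite addSn /= E.
Qed.

(* Tits' argument: strip from v a maximal alternating prefix in i and another
   letter j.  The braid relation makes the prefix shorter than m(i, j), so it
   sends the simple root to a nonnegative combination of two simple roots, and
   the induction hypothesis applies to both of them on what is left of v. *)
Theorem tits_nneg v i : (len (gprod v) <= len (gprod (i :: v)))%N ->
  nneg (e i *m mprod v).
Proof.
have [N] := ubnP (len (gprod v)).
elim: N v i => // N IH v i; rewrite ltnS => vN vi.
have [y0 yE ys] := len_ex gen v.
case: y0 yE ys => [|j y0] yE ys.
  have -> : mprod v = 1%:M by rewrite -(mprod_nil a); apply: mprod_gprod.
  by rewrite mulmx1 => l; rewrite mxE; case: (_ && _).
have ij : i != j.
  apply/negP => /eqP E; subst j; move: vi; rewrite gprod_cons -yE -gprod_cons gprod_consK //.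
  by have := len_le gen y0; rewrite yE -ys /=; lia.
have ji : j != i by rewrite eq_sym.
pose m := #[gen i * gen j]%g.
have Hm : half_turn (a i j) m by apply: cr_half.
pose Q k := `[< exists y, gprod (alt j i k ++ y) = gprod v /\
                          (size y + k = len (gprod v))%N >].
have Q1 : Q 1%N by apply/asboolP; exists y0; rewrite addn1.
(* With m alternating letters the braid relation would let a reduced expression of [v] start with
   [i], and [i :: v] would be shorter. *)
have Qlt k : Q k -> (k < m)%N.
  move=> /asboolP[y [E sy]]; rewrite ltnNge; apply/negP => mk.
  have [y1 [sy1 E1]] := alt_add j i m (k - m).
  rewrite subnKC // in E1.
  have m0 : (0 < m)%N by rewrite order_gt0.
  have Ev : gprod v = gprod (i :: alt j i m.-1 ++ y1 ++ y).
    rewrite -cat_cons -[i :: _]/(alt i j m.-1.+1) (prednK m0) -E E1 -catA.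
    by rewrite gprod_cat -(gprod_braid gen_ord (erefl m)) -gprod_cat.
  have Eiv : gprod (i :: v) = gprod (alt j i m.-1 ++ y1 ++ y).
    by rewrite gprod_cons Ev -gprod_cons gprod_consK.
  have := len_le gen (alt j i m.-1 ++ y1 ++ y).
  by rewrite -Eiv !size_cat size_alt sy1; lia.
have [k Qk kmax] : exists2 k, Q k & forall l, Q l -> (l <= k)%N.
  have Qm l : Q l -> (l <= m)%N by move=> /Qlt /ltnW.
  have exQ : exists l, Q l by exists 1%N.
  by case: (ex_maxnP exQ Qm) => k ? ?; exists k.
have km := Qlt _ Qk; have k0 := kmax _ Q1.
move: Qk => /asboolP[y [E sy]].
have ly : len (gprod y) = size y.
  apply/eqP; rewrite eqn_leq len_le /=.
  by have := len_cat gen (alt j i k) y; rewrite E size_alt; lia.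
have Ek : alt j i k = rcons (alt j i k.-1) (if odd k then j else i).
  by case: k k0 {km kmax y E sy ly} => // k _; rewrite alt_rcons /=; case: (odd k).
(* The prefix followed by [y] is reduced, so prepending the last letter of the prefix cannot shorten
   [y]. *)
have down : (len (gprod y) <= len (gprod ((if odd k then j else i) :: y)))%N.
  have := len_cat gen (alt j i k.-1) ((if odd k then j else i) :: y).
  by rewrite -cat_rcons -Ek E size_alt; lia.
(* Otherwise a shortest word for [y] could begin with the next alternating letter, against the
   maximality of [k]. *)
have up : (len (gprod y) <= len (gprod ((if odd k then i else j) :: y)))%N.
  rewrite leqNgt; apply/negP => lt.
  set z := if odd k then i else j in lt.
  have [y1 E1 sy1] := len_ex gen (z :: y).
  suff /kmax : Q k.+1 by rewrite ltnn.
  apply/asboolP; exists y1.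
  have Ev : gprod (alt j i k.+1 ++ y1) = gprod v.
    rewrite alt_rcons -/z cat_rcons -E !gprod_cat !gprod_cons E1 gprod_cons.
    by rewrite (mulgA (gen z)) gen_sq // mul1g.
  split=> //; have := len_le gen (alt j i k.+1 ++ y1).
  by rewrite Ev size_cat size_alt; lia.
have yN : (len (gprod y) < N)%N by lia.
have [pi pj] : nneg (e i *m mprod y) /\ nneg (e j *m mprod y).
  by move: up down; case: (odd k) => /(IH _ _ yN) ? /(IH _ _ yN) ?.
have -> : mprod v = mprod (alt j i k ++ y) by apply: mprod_gprod.
rewrite mprod_cat mulmxA e_alt // mulmxDl -!scalemxAl => l.
have cp q : (q <= m)%N -> 0 <= cheb (a i j) q.
  case: Hm => _ cm cpos; case: (posnP q) => [-> //|q0].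
  by rewrite leq_eqVlt => /orP[/eqP->|qm]; [rewrite cm | rewrite ltW // cpos ?q0].
rewrite !mxE; apply: addr_ge0; apply: mulr_ge0.
- by apply: cp; case: (odd k); lia.
- by have := pi l; rewrite mxE.
- by apply: cp; case: (odd k); lia.
- by have := pj l; rewrite mxE.
Qed.

Lemma e_cons i u : e i *m mprod (i :: u) = - (e i *m mprod u).
Proof. by rewrite mprod_cons mulmxA e_sig mulNmx. Qed.

Lemma root_sign u i : nneg (e i *m mprod u) \/ nneg (- (e i *m mprod u)).
Proof.
case: (leqP (len (gprod u)) (len (gprod (i :: u)))) => [/tits_nneg|H]; [by left|right].
rewrite -e_cons; apply: tits_nneg; rewrite gprod_consK //; exact: ltnW.
Qed.

Lemma left_descent u : gprod u != 1%g -> exists i v,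
  [/\ gprod u = gprod (i :: v), (len (gprod v) < len (gprod u))%N
    & nneg (- (e i *m mprod u))].
Proof.
move=> u1; have [y0 yE ys] := len_ex gen u.
case: y0 yE ys => [|i v] yE ys.
  by rewrite -yE gprod_nil eqxx in u1.
exists i, v; rewrite -yE.
have lt : (len (gprod v) < len (gprod (i :: v)))%N.
  by rewrite yE -ys /= ltnS len_le.
split=> //; rewrite (mprod_gprod (esym yE)) e_cons opprK.
by apply: tits_nneg; exact: ltnW.
Qed.

(** An element other than 1 makes some simple root nonpositive, whereas the identity matrix fixes
    them all. *)
Lemma mprod_faithful u v : mprod u = mprod v -> gprod u = gprod v.
Proof.
move=> E; apply/eqP; rewrite eq_mulVg1 -gprod_rev // -gprod_cat.
apply/negP => /negP /left_descent[i [y [_ _]]].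
rewrite mprod_cat -E mprod_revl mulmx1 => /(_ i).
by rewrite !mxE !eqxx oppr_ge0 ler10.
Qed.

Lemma sig_stab (c : 'cV[R]_n) i : c i 0 = 0 -> sig i *m c = c.
Proof.
move=> ci; rewrite mulmxBl mul1mx -mulmxA -rowE.
have -> : row i c = 0 by apply/rowP => l; rewrite !mxE ord1 ci.
by rewrite mulmx0 subr0.
Qed.

(** A left descent [i] of [u] sends [e i] to a nonpositive root, so c takes a value at [e i] that is
    both nonnegative and nonpositive. The letter then fixes [c] and can be stripped. *)
Lemma dominant_stab (c : 'cV[R]_n) u : (forall i, 0 <= c i 0) ->
  mprod u *m c = c ->
  exists2 y, all [pred i | c i 0 == 0] y & gprod u = gprod y.
Proof.
move=> c0; have [N] := ubnP (len (gprod u)).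
elim: N u => // N IH u; rewrite ltnS => uN uc.
have [u1|/left_descent[i [v [E lt neg]]]] := eqVneq (gprod u) 1%g.
  by exists [::] => //; rewrite u1 gprod_nil.
have ci : c i 0 = 0.
  apply/eqP; rewrite eq_le c0 andbT.
  have -> : c i 0 = \sum_l (e i *m mprod u) 0 l * c l 0.
    transitivity ((e i *m c) 0 0); first by rewrite -rowE mxE.
    by rewrite -{1}uc mulmxA mxE.
  apply: sumr_le0 => l _; apply: mulr_le0_ge0 => //.
  by have := neg l; rewrite mxE oppr_ge0.
have vc : mprod v *m c = c.
  rewrite -[RHS](sig_stab ci) -[in RHS]uc (mprod_gprod E) mprod_cons.
  by rewrite !mulmxA sig_sq // mul1mx.
have [|y yc yE] := IH v _ vc; first exact: leq_trans lt uN.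
by exists (i :: y); rewrite /= ?ci ?eqxx // E !gprod_cons yE.
Qed.

Lemma gram_sym : G^T = G.
Proof. by apply/matrixP => i j; rewrite !mxE eq_sym a_sym. Qed.

Lemma sig_gram i : sig i *m G *m (sig i)^T = G.
Proof.
have E : sig i *m G = G - col i G *m row i G.
  by rewrite mulmxBl mul1mx -mulmxA -rowE.
have Gt : (col i G)^T = row i G by rewrite tr_col gram_sym.
have -> : (sig i)^T = 1%:M - (e i)^T *m row i G.
  by rewrite linearB /= trmx1 trmx_mul Gt.
rewrite E mulmxBr mulmx1 mulmxBl !mulmxA trmx_delta -colE.
have -> : col i G *m row i G *m delta_mx i 0 = 2 *: col i G.
  rewrite -mulmxA -colE [col i (row i G)]mx11_scalar mul_mx_scalar.
  by rewrite !mxE eqxx.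
by rewrite -scalemxAl scaler_nat mulr2n opprB addrK subrK.
Qed.

Lemma mprod_gram u : mprod u *m G *m (mprod u)^T = G.
Proof.
elim: u => [|i u IH]; first by rewrite mprod_nil mul1mx trmx1 mulmx1.
by rewrite mprod_cons trmx_mul !mulmxA -(mulmxA (sig i)) -(mulmxA (sig i)) IH sig_gram.
Qed.

Lemma mprod_reflection u i :
  mprod (rev u ++ i :: u) = 1%:M - G *m (e i *m mprod u)^T *m (e i *m mprod u).
Proof.
rewrite mprod_cat mprod_cons mulmxA mulmxBr mulmx1 mulmxBl mprod_revl; congr (_ - _).
rewrite !mulmxA trmx_mul colE trmx_delta !mulmxA; congr (_ *m _ *m _ *m _).
by rewrite -{1}(mprod_gram u) !mulmxA mprod_revl mul1mx.
Qed.

Lemma root_norm u i : (e i *m mprod u) *m G *m (e i *m mprod u)^T = 2%:M.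
Proof.
rewrite trmx_mul !mulmxA -(mulmxA (e i)) -(mulmxA (e i)) mprod_gram trmx_delta -colE.
by rewrite [LHS]mx11_scalar mxE eGii.
Qed.

Lemma root_neq0 u i : e i *m mprod u != 0.
Proof.
apply/eqP => E; have := root_norm u i; rewrite E !mul0mx => /matrixP /(_ 0 0).
by rewrite !mxE /= => /eqP; rewrite eq_sym pnatr_eq0.
Qed.

(** All roots have the same norm, which forces c^2 = 1; the reflection matrices agree and
    faithfulness concludes. *)
Lemma reflection_eq u i v j (c : R) : e i *m mprod u = c *: (e j *m mprod v) ->
  (gen i ^ gprod u = gen j ^ gprod v)%g.
Proof.
move=> E; rewrite -!gprod_conj //; apply: mprod_faithful.
rewrite !mprod_reflection E.
have /eqP c2 : c ^+ 2 == 1.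
  have := root_norm u i; rewrite E linearZ /= -!scalemxAl -scalemxAr root_norm.
  move=> /matrixP /(_ 0 0); rewrite !mxE eqxx !mulr1n => H.
  by apply/eqP; lra.
by rewrite [(c *: _)^T]linearZ /= -!scalemxAr -scalemxAl scalerA -expr2 c2 scale1r.
Qed.

(* The root changes sign along y, and the letter at which it does is its
   image up to sign, because s_j permutes the other positive roots. *)
Lemma root_cross (J : {set 'I_n}) u i y : all (mem J) y ->
  nneg (e i *m mprod u) -> nneg (- (e i *m mprod (u ++ y))) ->
  exists j z, [/\ j \in J, all (mem J) z & (gen i ^ gprod u = gen j ^ gprod z)%g].
Proof.
elim: y u => [|j y IH] u /=.
  move=> _ p q; rewrite cats0 in q.
  by have := root_neq0 u i; rewrite (nneg_anti p q) eqxx.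
move=> /andP[jJ yJ] p q.
have uj : e i *m mprod (rcons u j) = (e i *m mprod u) *m sig j.
  by rewrite mprod_rcons mulmxA.
have [p'|q'] := root_sign (rcons u j) i.
  rewrite -cat_rcons in q.
  have [k [z [kJ zJ E]]] := IH _ yJ p' q.
  exists k, (rcons z j); rewrite kJ all_rcons /= jJ zJ; split=> //.
  move: E; rewrite -!cats1 !gprod_cat gprod1 !conjgM => <-.
  by rewrite -conjgM gen_sq // conjg1.
exists j, [::]; rewrite jJ; split=> //.
apply: (@reflection_eq _ _ _ _ ((e i *m mprod u) 0 j)).
rewrite mprod_nil mulmx1; set c := _ 0 j; apply/rowP => l.
rewrite [RHS]mxE [in RHS]mxE /=.
have [->|lj] := eqVneq l j; first by rewrite mulr1.
rewrite mulr0; apply/eqP; rewrite eq_le p andbT.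
by have := q' l; rewrite uj mxE oppr_ge0 sig_coord.
Qed.

(** A reflection negates its own root. Written as a word in [J], it must do so at some letter, and
    [root_cross] reads off a conjugate inside the parabolic subgroup. *)
Lemma parabolic_reflection (J : {set 'I_n}) u i y : all (mem J) y ->
  (gen i ^ gprod u)%g = gprod y ->
  exists j z, [/\ j \in J, all (mem J) z & (gen i ^ gprod u = gen j ^ gprod z)%g].
Proof.
move=> yJ E.
have E' v : (gen i ^ gprod v)%g = gprod y ->
    e i *m mprod (v ++ y) = - (e i *m mprod v).
  rewrite -gprod_conj // => /mprod_gprod Ev.
  by rewrite mprod_cat -Ev mprod_cat (mulmxA (mprod v)) mprod_revr mul1mx e_cons.
have [p|q] := root_sign u i.
  by apply: (root_cross yJ p); rewrite E' ?opprK.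
(* A negative root is replaced by its opposite, which belongs to the same reflection. *)
have Eu : (gen i ^ gprod (i :: u) = gen i ^ gprod u)%g.
  by rewrite gprod_cons conjgM (conjgE (gen i) (gen i)) mulKg.
rewrite -Eu; apply: (root_cross yJ); first by rewrite e_cons.
by rewrite E' ?Eu // opprK e_cons.
Qed.

End Representation.

(** * The invariant form and reduced reflection words *)

Section InvariantForm.
Variables (gT : finGroupType) (n : nat) (gen : 'I_n -> gT) (R : realFieldType)
  (a : 'I_n -> 'I_n -> R).
Hypothesis Hrep : coxeter_rep gen a.
Implicit Types (i j : 'I_n) (u v y : seq 'I_n) (x : 'rV[R]_n).
Local Notation G := (gram a).
Local Notation e i := (delta_mx 0 i : 'rV[R]_n).
Local Notation gprod := (gprod gen).
Local Notation sig := (sig a).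
Local Notation mprod := (mprod a).
Let gen_ord := cr_ord Hrep.
Let a_sym := cr_sym Hrep.

Definition rho (w : gT) : 'M[R]_n :=
  if pselect (exists u, gprod u = w) is left H then mprod (projT1 (cid H)) else 1%:M.

Lemma rho_gprod u : rho (gprod u) = mprod u.
Proof.
rewrite /rho; case: pselect => [H|[]]; last by exists u.
by case: (cid H) => v /= /(mprod_gprod Hrep).
Qed.

(** Averaging over the finite group yields a positive definite invariant form. *)
Definition avg : 'M[R]_n := \sum_(w in <<gen @: setT>>%g) rho w *m (rho w)^T.

Lemma avg_sig i : sig i *m avg *m (sig i)^T = avg.
Proof.
rewrite /avg [RHS](reindex_inj (mulgI (gen i))) /=.
rewrite mulmx_sumr mulmx_suml; apply: eq_big => [w|w wW].
  by rewrite groupMl // mem_gen // imset_f.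
have [u _ <-] := gprod_genP gen _ _ wW.
by rewrite -gprod_cons !rho_gprod mprod_cons trmx_mul !mulmxA.
Qed.

Lemma avg_ge0 x : 0 <= (x *m avg *m x^T) 0 0.
Proof.
rewrite mulmx_sumr mulmx_suml summxE; apply: sumr_ge0 => w _.
rewrite !mulmxA -mulmxA -trmx_mul mxE; apply: sumr_ge0 => l _.
by rewrite [(_^T) _ _]mxE -expr2 sqr_ge0.
Qed.

Lemma avg_eq0 x : (x *m avg *m x^T) 0 0 = 0 -> x = 0.
Proof.
rewrite mulmx_sumr mulmx_suml summxE => /eqP; rewrite psumr_eq0; last first.
  move=> w _; rewrite !mulmxA -mulmxA -trmx_mul mxE; apply: sumr_ge0 => l _.
  by rewrite [(_^T) _ _]mxE -expr2 sqr_ge0.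
move=> /allP /(_ 1%g); rewrite mem_index_enum group1 => /(_ isT) /=.
rewrite -(gprod_nil gen) rho_gprod mprod_nil trmx1 !mulmx1 mxE.
rewrite psumr_eq0; last by move=> l _; rewrite [(_^T) _ _]mxE -expr2 sqr_ge0.
move=> /allP H; apply/rowP => l; rewrite [RHS]mxE; apply/eqP.
by have := H l (mem_index_enum _); rewrite /= mxE mulf_eq0 orbb.
Qed.

(** Invariance under [sig i], which negates [e i], makes the two forms proportional on pairs with
    [e i]. The factor is positive, so signs and kernels transfer to [gram]. *)
Lemma avg_pair x i :
  2 * (x *m avg *m (e i)^T) 0 0 = (x *m G) 0 i * (e i *m avg *m (e i)^T) 0 0.
Proof.
have : x *m avg *m (e i)^T = (x *m sig i) *m avg *m (e i *m sig i)^T.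
  by rewrite trmx_mul -{1}(avg_sig i) !mulmxA.
rewrite e_sig act_sig linearN /= mulmxN !(mulmxBl, =^~ scalemxAl) opprB.
move=> /matrixP /(_ 0 0); rewrite [RHS]mxE [X in _ = X + _]mxE [X in _ = _ + X]mxE; lra.
Qed.

Lemma gram_ker x : x *m G = 0 -> x = 0.
Proof.
move=> xG; apply: avg_eq0.
have E i : (x *m avg) 0 i = 0.
  have := avg_pair x i; rewrite [(x *m G) 0 i](_ : _ = 0); last by rewrite xG mxE.
  rewrite mul0r trmx_delta -colE mxE => /eqP.
  by rewrite mulf_eq0 pnatr_eq0 /= => /eqP.
by rewrite mxE big1 // => i _; rewrite E mul0r.
Qed.

Lemma gram_unit : G \in unitmx.
Proof.
rewrite -row_free_unit -kermx_eq0; apply/eqP/row_matrixP => i; rewrite row0.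
by apply: gram_ker; rewrite -row_mul mulmx_ker row0.
Qed.

Definition nbr i j := (i != j) && (2 < #[gen i * gen j]%g)%N.

Lemma nbrI : irreflexive nbr.
Proof. by move=> i; rewrite /nbr eqxx. Qed.

Lemma nbr_sym : symmetric nbr.
Proof.
move=> i j; rewrite /nbr eq_sym; congr (_ && (_ < _)%N).
by rewrite -[in LHS]orderV invMg !gen_inv.
Qed.

Lemma nbrN_commute i j : ~~ nbr i j -> commute (gen i) (gen j).
Proof.
rewrite negb_and negbK -leqNgt => /orP[/eqP ->//|o2].
have : (gen i * gen j * (gen i * gen j) = 1)%g.
  case: #[gen i * gen j]%g (order_gt0 (gen i * gen j)) o2 (expg_order (gen i * gen j)) => [|[|[|]]] //.
  by move=> _ _; rewrite expg1 => ->; rewrite mulg1.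
move=> /eqP; rewrite -eq_invg_mul invMg !gen_inv // => /eqP E.
by rewrite /commute E.
Qed.

(* Otherwise the sum of the simple roots of J has nonpositive norm for the
   invariant form. *)
Lemma leaf_ex (J : {set 'I_n}) : J != finset.set0 ->
  exists2 i, i \in J & (#|[set j in J | nbr i j]| <= 1)%N.
Proof.
move=> J0; case: (pselect (exists2 i, i \in J & (#|[set j in J | nbr i j]| <= 1)%N)) => // no.
pose x : 'rV[R]_n := \row_j (j \in J)%:R.
have xE : x = \sum_(i in J) e i.
  apply/rowP => l; rewrite summxE mxE; case: (boolP (l \in J)) => lJ.
    rewrite (bigD1 l) //= mxE !eqxx big1 ?addr0 // => i /andP[_ il].
    by rewrite mxE eq_sym (negPf il) andbF.
  rewrite big1 // => i iJ; rewrite mxE eqxx /=; case: eqP => // E.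
  by rewrite E iJ in lJ.
have xG i : i \in J -> (x *m G) 0 i <= 0.
  move=> iJ; rewrite xE mulmx_suml summxE (bigD1 i) //= eGii.
  (* Each of at least two neighbours contributes at most -1, against the 2 of [i] itself. *)
  have D : 2 <= #|[set j in J | nbr i j]|%:R :> R.
    rewrite ler_nat ltnNge; apply/negP => H; by apply: no; exists i.
  suff : \sum_(j in J | j != i) (e j *m G) 0 i <= - #|[set j in J | nbr i j]|%:R by lra.
  rewrite -sumr_const -sumrN big_mkcond /= [X in _ <= X]big_mkcond.
  apply: ler_sum => j _; rewrite inE /nbr; case: (j \in J) => //=.
  rewrite (eq_sym i j) eG; case: (eqVneq j i) => //= ji.
  rewrite eq_sym in ji; rewrite a_sym; have H := cr_half Hrep ji.
  case: ltnP => [lt|_]; first by rewrite lerN2; apply: half_turn_ge1 H lt.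
  by rewrite oppr_le0; apply: half_turn_ge0 H.
have x0 : x = 0.
  apply: avg_eq0; apply/eqP; rewrite eq_le avg_ge0 andbT.
  rewrite [x^T](_ : _ = \sum_(i in J) (e i)^T); last by rewrite {1}xE linear_sum.
  rewrite mulmx_sumr summxE; apply: sumr_le0 => i iJ.
  have := avg_pair x i; have := avg_ge0 (e i); have := xG i iJ; nra.
move: J0 => /set0Pn[i iJ]; move/rowP: x0 => /(_ i).
by rewrite !mxE iJ => /eqP; rewrite oner_eq0.
Qed.

Lemma mprod_fix x u : (forall j, j \in u -> (x *m G) 0 j = 0) -> x *m mprod u = x.
Proof.
elim: u => [|i u IH] H; first by rewrite mprod_nil mulmx1.
rewrite mprod_cons mulmxA act_sig H ?mem_head // scale0r subr0 IH // => j ju.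
by rewrite H // inE ju orbT.
Qed.

(* The y are combinations of the dual basis of the letters of l for [gram]. *)
Lemma cox_image (l : seq 'I_n) i : uniq l -> i \in l ->
  exists y : 'rV[R]_n, (forall j, j \notin l -> (y *m G) 0 j = 0) /\ y *m (mprod l - 1%:M) = e i.
Proof.
elim: l i => // k l IH i /= /andP[kl ul].
have supp (z : 'rV[R]_n) : (forall j, j \notin l -> (z *m G) 0 j = 0) ->
    z *m (mprod (k :: l) - 1%:M) = z *m (mprod l - 1%:M).
  by move=> zl; rewrite !mulmxBr mprod_cons mulmxA act_sig zl // scale0r subr0.
have big_ex (x : 'rV[R]_n) : (forall j, j \notin l -> x 0 j = 0) ->
    exists z : 'rV[R]_n, (forall j, j \notin l -> (z *m G) 0 j = 0) /\ z *m (mprod l - 1%:M) = x.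
  move=> xl.
  have [f fP] : exists f : 'I_n -> 'rV[R]_n, forall j, j \in l ->
      (forall q, q \notin l -> (f j *m G) 0 q = 0) /\ f j *m (mprod l - 1%:M) = e j.
    have ex j : exists y : 'rV[R]_n, j \in l ->
        (forall q, q \notin l -> (y *m G) 0 q = 0) /\ y *m (mprod l - 1%:M) = e j.
      case: (boolP (j \in l)) => [jl|]; last by exists 0.
      by have [y yP] := IH j ul jl; exists y.
    by exists (fun j => projT1 (cid (ex j))) => j; case: (cid (ex j)).
  exists (\sum_(j | j \in l) x 0 j *: f j); split.
    move=> q ql; rewrite mulmx_suml summxE big1 // => j jl.
    by rewrite -scalemxAl mxE (proj1 (fP j jl)) // mulr0.
  rewrite mulmx_suml [RHS]row_sum_delta [RHS](bigID (mem l)) /= [X in _ = _ + X]big1.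
    by rewrite addr0; apply: eq_bigr => j jl; rewrite -scalemxAl (proj2 (fP j jl)).
  by move=> j jl; rewrite xl // scale0r.
rewrite inE => /orP[/eqP ->|il]; last first.
  have [y [y1 y2]] := IH i ul il; exists y; rewrite supp //; split=> // j.
  by rewrite inE negb_or => /andP[_]; exact: y1.
(* [xk] is dual to [e k] for [gram]: the word [k :: l] minus 1 sends it to minus the image of [e k]
   under [l], and [z] corrects the difference from [e k]. *)
pose xk : 'rV[R]_n := e k *m invmx G.
have xkG : xk *m G = e k by rewrite -mulmxA mulVmx ?gram_unit // mulmx1.
have [|z [z1 z2]] := big_ex (e k *m (mprod l - 1%:M)).
  move=> j jl; rewrite mulmxBr mulmx1; have := mprod_coord a (e k) jl.
  by move=> H; rewrite mxE H [X in _ + X]mxE subrr.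
have xkl : xk *m (mprod (k :: l) - 1%:M) = - (e k *m mprod l).
  rewrite mulmxBr mulmx1 mprod_cons mulmxA act_sig xkG mxE !eqxx scale1r mulmxBl.
  rewrite (@mprod_fix xk l); first by rewrite addrAC subrr add0r.
  by move=> j jl; rewrite xkG mxE /=; case: eqP jl kl => // -> ->.
exists (- xk - z); split.
  move=> j; rewrite inE negb_or => /andP[jk jl].
  rewrite mulmxBl mulNmx xkG mxE [X in _ + X]mxE z1 // subr0 !mxE (negPf jk).
  by rewrite andbF oppr0.
rewrite mulmxBl mulNmx xkl opprK supp // z2 mulmxBr mulmx1.
by rewrite opprB addrC subrK.
Qed.

(** * Words in reflections *)

Implicit Types (p : seq 'I_n * 'I_n) (rs : seq (seq 'I_n * 'I_n)).

(** A pair (u, i) encodes the reflection u^-1 s_i u, which keeps a root at hand for each reflection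
    letter. *)
Definition refw p : seq 'I_n := rev p.1 ++ p.2 :: p.1.
Definition word_root p : 'rV[R]_n := e p.2 *m mprod p.1.
Definition word_refl p : gT := (gen p.2 ^ gprod p.1)%g.

Lemma gprod_refw p : gprod (refw p) = word_refl p.
Proof. exact: gprod_conj. Qed.

Fixpoint rootmx rs : 'M[R]_(size rs, n) :=
  if rs is p :: rs' then col_mx (word_root p) (rootmx rs') else 0.

Lemma rootmx_cons p rs k (D : 'M[R]_(k, n)) :
  (D <= rootmx (p :: rs))%MS = (D <= word_root p + rootmx rs)%MS.
Proof. by rewrite (addsmxE (word_root p) (rootmx rs)). Qed.

Lemma rootmx_sub rs p : p \in rs -> (word_root p <= rootmx rs)%MS.
Proof.
elim: rs => // q rs IH; rewrite inE => /orP[/eqP <-|/IH H].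
  by rewrite rootmx_cons addsmxSl.
by rewrite rootmx_cons (submx_trans H) // addsmxSr.
Qed.

(** A reflection differs from 1 by a matrix whose rows are multiples of its root; telescoping the
    product collects the roots. *)
Lemma refws_sub rs :
  (mprod (flatten (map refw rs)) - 1%:M <= rootmx rs)%MS.
Proof.
elim: rs => [|p rs IH]; first by rewrite mprod_nil subrr sub0mx.
rewrite rootmx_cons [map _ _]/= [flatten _]/=.
rewrite mprod_cat (_ : _ - _ = (mprod (refw p) *m (mprod (flatten (map refw rs)) - 1%:M))
   + (mprod (refw p) - 1%:M)); last by rewrite mulmxBr mulmx1 addrA subrK.
rewrite addmx_sub //.
  by rewrite (submx_trans _ (addsmxSr _ _)) // mulmx_sub.
rewrite (submx_trans _ (addsmxSl _ _)) // (mprod_reflection Hrep).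
by rewrite addrC addrA addNr add0r -mulNmx submxMl.
Qed.

(* Carter's lemma for Coxeter elements: the image of c - 1 contains the simple
   roots of l and lies in the span of the roots of any reflection word for c.
   In case of equality these roots vanish on a form whose stabilizer is the
   parabolic subgroup of l. *)
Lemma coxeter_reflection_word (l : seq 'I_n) rs : uniq l ->
  gprod l = gprod (flatten (map refw rs)) ->
  (size l <= size rs)%N /\ (size rs = size l -> forall p, p \in rs -> exists j z,
     [/\ j \in l, all (mem l) z & word_refl p = (gen j ^ gprod z)%g]).
Proof.
move=> ul /(mprod_gprod Hrep) El.
pose E : 'M[R]_(size l, n) := \matrix_k e (tnth (in_tuple l) k).
have subE : (E <= rootmx rs)%MS.
  apply/row_subP => k; rewrite rowK.
  have [y [_ <-]] := cox_image ul (mem_tnth k (in_tuple l)).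
  by rewrite mulmx_sub // El refws_sub.
have rE : \rank E = size l.
  apply/eqP; change (row_free E); apply/row_freeP; exists E^T.
  apply/matrixP => k k'; rewrite !mxE (bigD1 (tnth (in_tuple l) k)) //= big1.
    rewrite addr0 !mxE !eqxx mul1r /=; congr (_%:R).
    have /tuple_uniqP inj : uniq (in_tuple l) by [].
    by rewrite (inj_eq inj).
  by move=> q qk; rewrite !mxE (negPf qk) andbF mul0r.
have rB := mxrankS subE; rewrite rE in rB.
split; first exact: leq_trans rB (rank_leq_row _).
move=> sz p prs.
have subB : (rootmx rs <= E)%MS.
  rewrite -(geq_leqif (mxrank_leqif_sup subE)) rE -sz.
  exact: rank_leq_row.
have [D rD] := submxP (submx_trans (rootmx_sub prs) subB).
(* A dominant form whose zeros among the simple roots are those of [l]; as the two spans agree, it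
   vanishes at the roots of [rs] too. *)
pose c : 'cV[R]_n := \col_i (i \notin l)%:R.
have Ec : E *m c = 0.
  apply/row_matrixP => k; rewrite row_mul rowK row0 -rowE; apply/rowP => q.
  by rewrite !mxE mem_tnth.
have pc : mprod (refw p) *m c = c.
  have gc : word_root p *m c = 0 by rewrite rD -mulmxA Ec mulmx0.
  by rewrite (mprod_reflection Hrep) -/(word_root p) mulmxBl mul1mx -(mulmxA (G *m _)) gc mulmx0 subr0.
have [|y yl yE] := dominant_stab Hrep _ pc.
  by move=> i; rewrite mxE ler0n.
have yJ : all (mem [set i | i \in l]) y.
  apply: sub_all yl => i /=; rewrite mxE inE.
  by case: (i \in l) => //; rewrite oner_eq0.
have := parabolic_reflection Hrep yJ (_ : (gen p.2 ^ gprod p.1)%g = gprod y).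
rewrite -yE gprod_refw => /(_ erefl) [j [z [jl zl Ez]]].
exists j, z; rewrite inE in jl; split=> //.
by apply: sub_all zl => q /=; rewrite inE.
Qed.

End InvariantForm.

(** * The bipartite Coxeter element *)

Section Bipartite.
Variables (gT : finGroupType) (n : nat) (gen : 'I_n -> gT) (R : realFieldType)
  (a : 'I_n -> 'I_n -> R).
Hypothesis Hrep : coxeter_rep gen a.
Variables (col : 'I_n -> bool) (i0 : 'I_n) (x : 'I_n -> R) (la : R).
Hypotheses (Hcol : forall i j, nbr gen i j -> col i != col j) (i0_col : col i0)
  (x_gt0 : forall i, 0 < x i)
  (x_eig : forall i, \sum_(j | j != i) a i j * x j = la * x i).
Implicit Types (i j k : 'I_n) (u v y : seq 'I_n).
Local Notation G := (gram a).
Local Notation e i := (delta_mx 0 i : 'rV[R]_n).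
Local Notation gprod := (gprod gen).
Local Notation sig := (sig a).
Local Notation mprod := (mprod a).
Let gen_ord := cr_ord Hrep.
Let a_sym := cr_sym Hrep.

Definition side b : seq 'I_n := [seq i <- enum 'I_n | col i == b].
(** One colour class of the positive eigenvector, as a linear form; the two rays add up to a point
    inside the fundamental chamber. *)
Definition ray b : 'cV[R]_n := \col_i (if col i == b then x i else 0).

Lemma mem_side b i : (i \in side b) = (col i == b).
Proof. by rewrite mem_filter mem_enum andbT. Qed.

Lemma side_uniq b : uniq (side b).
Proof. by rewrite filter_uniq // enum_uniq. Qed.

Lemma same_side_order i j : col i = col j -> i != j -> #[gen i * gen j]%g = 2%N.
Proof.
move=> cij ij; apply/eqP; rewrite eqn_leq; apply/andP; split.
  rewrite leqNgt; apply/negP => H; have := @Hcol i j.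
  by rewrite /nbr ij H cij eqxx => /(_ isT).
exact: half_turn_gt1 (cr_half Hrep ij).
Qed.

Lemma same_side_commute i j : col i = col j -> commute (gen i) (gen j).
Proof.
move=> cij; apply: (nbrN_commute Hrep); apply/negP => /Hcol.
by rewrite cij eqxx.
Qed.

Lemma same_side_conj i u : all [pred j | col j == col i] u -> (gen i ^ gprod u = gen i)%g.
Proof.
elim: u => [|j u IH] /=; first by rewrite gprod_nil conjg1.
move=> /andP[/eqP ji /IH E]; rewrite gprod_cons conjgM.
have -> : (gen i ^ gen j = gen i)%g by rewrite conjgE (same_side_commute (esym ji)) mulKg.
exact: E.
Qed.

Lemma same_side_gprod i u : all [pred j | col j == col i] u ->
  commute (gen i) (gprod u).
Proof. by move=> H; rewrite /commute conjgC same_side_conj. Qed.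

Lemma same_side_a i j : col i = col j -> i != j -> a i j = 0.
Proof.
by move=> cij ij; apply: half_turn2 (cr_half Hrep ij) _; apply: same_side_order.
Qed.

Lemma sig_dual i (c : 'cV[R]_n) : sig i *m c = c - c i 0 *: matrix.col i G.
Proof.
rewrite mulmxBl mul1mx -mulmxA -rowE; congr (_ - _).
by rewrite [row i c]mx11_scalar mul_mx_scalar mxE.
Qed.

(** Distinct letters of one colour are orthogonal, so each acts as if the others were absent. *)
Lemma side_dual b u (c : 'cV[R]_n) : uniq u -> all [pred i | col i == b] u ->
  mprod u *m c = c - \sum_(i <- u) c i 0 *: matrix.col i G.
Proof.
elim: u => [|k u IH]; first by rewrite mprod_nil mul1mx big_nil subr0.
move=> /= /andP[ku uu] /andP[/eqP kb ub].
rewrite mprod_cons -mulmxA IH // sig_dual big_cons opprD addrA [RHS]addrAC; congr (_ - _ *: _).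
rewrite !mxE summxE big_seq big1 ?subr0 // => i iu; rewrite !mxE.
have ki : k != i by apply/eqP => E; rewrite E iu in ku.
rewrite (negPf ki) same_side_a ?oppr0 ?mulr0 // kb.
by have /allP/(_ i iu)/eqP := ub.
Qed.

Lemma side_ray_fix b : mprod (side b) *m ray (~~ b) = ray (~~ b).
Proof.
rewrite (@side_dual b) ?side_uniq // ?filter_all // big_seq big1 ?subr0 // => i.
by rewrite mem_side => /eqP E; rewrite mxE E; case: (b); rewrite scale0r.
Qed.

(** The eigenvector equation turns the sum over one colour class into [la] times the entries on the
    other. With [side_ray_fix] this keeps the plane of the rays stable. *)
Lemma side_ray b : mprod (side b) *m ray b = la *: ray (~~ b) - ray b.
Proof.
rewrite (@side_dual b) ?side_uniq // ?filter_all //; apply/colP => j.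
rewrite !mxE summxE big_filter big_enum_cond /=.
rewrite (eq_bigr (fun i => x i * G j i)); last first.
  by move=> i ib; rewrite !mxE ib.
have [jb|jb] := boolP (col j == b).
  have -> : (col j == ~~ b) = false by move: jb; case: (col j); case: b.
  rewrite (bigD1 j) //= big1 ?addr0 => [|i /andP[ib ij]].
    by rewrite mxE eqxx; ring.
  rewrite mxE eq_sym (negPf ij) same_side_a ?oppr0 ?mulr0 // 1?eq_sym //.
  by rewrite (eqP jb) (eqP ib).
have -> : col j == ~~ b by move: jb; case: (col j); case: b.
rewrite subr0 -x_eig sub0r -sumrN; rewrite big_mkcond [RHS]big_mkcond.
apply: eq_bigr => i _; have [ij|ij] := eqVneq i j.
  by rewrite ij (negPf jb).
case: eqP => ib; first by rewrite mxE eq_sym (negPf ij) mulrN opprK mulrC.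
rewrite same_side_a ?mul0r // 1?eq_sym //.
by move: jb ib; case: (col j); case: (col i); case: b.
Qed.

(* [walk j] is the word c_+ c_- c_+ ... with j factors; its chamber meets the
   plane spanned by [ray true] and [ray false] in the cone on
   [cone_ray j], [cone_ray j.+1]. *)
Definition walk (j : nat) : seq 'I_n := flatten (alt (side true) (side false) j).
Definition cone_ray (j : nat) : 'cV[R]_n := mprod (walk j) *m ray (~~ odd j).

Lemma walkS (j : nat) : walk j.+1 = walk j ++ side (~~ odd j).
Proof. by rewrite /walk alt_rcons flatten_rcons; case: (odd j). Qed.

Lemma cone_rayS (j : nat) : cone_ray j.+1 = mprod (walk j) *m ray (odd j).
Proof.
rewrite /cone_ray walkS mprod_cat -mulmxA /= negbK.
by rewrite -{2 3}[odd j]negbK side_ray_fix.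
Qed.

Lemma cone_raySS (j : nat) : cone_ray j.+2 = la *: cone_ray j.+1 - cone_ray j.
Proof.
rewrite (cone_rayS j.+1) walkS mprod_cat -mulmxA side_ray negbK mulmxBr -scalemxAr.
by rewrite -cone_rayS.
Qed.

Definition cox := gprod (side true ++ side false).

Lemma walk_double (j : nat) : gprod (walk j.*2) = (cox ^+ j)%g.
Proof.
elim: j => [|j IH]; first by rewrite gprod_nil.
rewrite doubleS !walkS /= odd_double /= -catA gprod_cat IH expgSr.
by [].
Qed.

Lemma walk_doubleD (j k : nat) : gprod (walk (j.*2 + k)) = (cox ^+ j * gprod (walk k))%g.
Proof.
elim: k => [|k IH]; first by rewrite addn0 walk_double gprod_nil mulg1.
by rewrite addnS !walkS !gprod_cat IH oddD odd_double mulgA.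
Qed.

Lemma cone_ray_period (k : nat) : cone_ray (#[cox]%g.*2 + k) = cone_ray k.
Proof.
rewrite /cone_ray oddD odd_double /=; congr (_ *m _); apply: (mprod_gprod Hrep).
by rewrite walk_doubleD expg_order mul1g.
Qed.

Section Root.
Variables (i : 'I_n) (y : seq 'I_n).
Let gam : 'rV[R]_n := e i *m mprod y.
Definition rootval (j : nat) := (gam *m cone_ray j) 0 0.

Lemma rootval_rec : chebrec la rootval.
Proof.
by move=> j; rewrite /rootval cone_raySS mulmxBr -scalemxAr mxE [X in X + _]mxE [X in _ + X]mxE.
Qed.

(** Moving the walk from the rays to the root turns two consecutive values into those of one
    positive or negative root on the initial rays. *)
Lemma rootval_walk (j : nat) :
  exists g : 'rV[R]_n, [/\ g != 0, nneg g \/ nneg (- g),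
    rootval j = (g *m ray (~~ odd j)) 0 0 & rootval j.+1 = (g *m ray (odd j)) 0 0].
Proof.
exists (e i *m mprod (y ++ walk j)); split.
- exact: root_neq0 Hrep _ _.
- exact: root_sign Hrep _ _.
- by rewrite /rootval /cone_ray mprod_cat !mulmxA.
- by rewrite /rootval cone_rayS mprod_cat !mulmxA.
Qed.
End Root.

Lemma nneg_ray (g : 'rV[R]_n) b : nneg g -> 0 <= (g *m ray b) 0 0.
Proof.
move=> gp; rewrite mxE; apply: sumr_ge0 => i _; rewrite mxE mulr_ge0 //.
by case: ifP => // _; apply/ltW.
Qed.

Lemma nneg_ray0 (g : 'rV[R]_n) b : nneg g -> (g *m ray b) 0 0 = 0 ->
  forall i, col i = b -> g 0 i = 0.
Proof.
move=> gp; rewrite mxE => /eqP; rewrite psumr_eq0; last first.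
  by move=> i _; rewrite mxE mulr_ge0 //; case: ifP => // _; apply/ltW.
move=> /allP H i ib; have := H i (mem_index_enum _).
by rewrite /= mxE ib eqxx mulf_eq0 (gt_eqF (x_gt0 i)) orbF => /eqP.
Qed.

Lemma root_ray0 (g : 'rV[R]_n) b : nneg g \/ nneg (- g) -> (g *m ray b) 0 0 = 0 ->
  forall i, col i = b -> g 0 i = 0.
Proof.
case=> gn g0 i ib; first exact: nneg_ray0 gn g0 _ ib.
apply/eqP; rewrite -oppr_eq0; apply/eqP.
have := nneg_ray0 gn _ ib; rewrite mulNmx mxE g0 oppr0 => /(_ erefl).
by rewrite mxE.
Qed.

Lemma rootval_sign i y (j : nat) : 0 <= rootval i y j * rootval i y j.+1.
Proof.
have [g [_ gs -> ->]] := rootval_walk i y j.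
case: gs => gp; first by rewrite mulr_ge0 // nneg_ray.
rewrite -mulrNN; have H b := nneg_ray b gp.
by apply: mulr_ge0; [have := H (~~ odd j) | have := H (odd j)]; rewrite mulNmx mxE.
Qed.

Lemma rootval_neq0 i y (j : nat) : (rootval i y j != 0) || (rootval i y j.+1 != 0).
Proof.
have [g [g0 gs -> ->]] := rootval_walk i y j.
rewrite -negb_and; apply: contra g0 => /andP[/eqP z1 /eqP z2].
apply/eqP/rowP => l; rewrite mxE.
have [E|E] := eqVneq (col l) (odd j); first exact: root_ray0 gs z2 _ E.
by apply: root_ray0 gs z1 _ _; move: E; case: (col l); case: (odd j).
Qed.

(** The simple root of [i0] vanishes on [cone_ray 1]. Its values are thus a multiple of [cheb la],
    which inherits their signs and their period. *)
Lemma cheb_rootval (k : nat) : rootval i0 [::] k.+1 = - x i0 * cheb la k.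
Proof.
have r1 : rootval i0 [::] 1 = 0.
  by rewrite /rootval cone_rayS mprod_nil mulmx1 mul1mx -rowE !mxE i0_col.
have r0 : rootval i0 [::] 0 = x i0.
  by rewrite /rootval /cone_ray mprod_nil mulmx1 mul1mx -rowE !mxE i0_col.
have := chebrec_zero k (rootval_rec i0 [::]) r1.
by rewrite (rootval_rec i0 [::] 0) r1 r0 mulr0 sub0r add1n.
Qed.

Lemma cheb_sign (k : nat) : 0 <= cheb la k * cheb la k.+1.
Proof.
have := rootval_sign i0 [::] k.+1; rewrite !cheb_rootval.
rewrite mulrACA mulrNN => H; have x2 : 0 < x i0 * x i0 by rewrite mulr_gt0.
by rewrite -(pmulr_rge0 _ x2).
Qed.

Lemma cheb_period (k : nat) : cheb la (#[cox]%g.*2 + k) = cheb la k.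
Proof.
have x0 : - x i0 != 0 by rewrite oppr_eq0 gt_eqF.
apply: (mulfI x0); rewrite -!cheb_rootval -addnS /rootval.
by rewrite cone_ray_period.
Qed.

(* The zeros of every [rootval] are spaced by the first positive zero m of
   [cheb la]: then c^m fixes the interior point [ray true + ray false] of the
   chamber, so c^m = 1, while c^h = 1 makes the sequences 2h-periodic. *)
Lemma cox_half_turn : half_turn la #[cox]%g.
Proof.
set H := #[cox]%g; have H0 : (0 < H)%N by rewrite order_gt0.
have exm : exists m, (0 < m)%N && (cheb la m == 0).
  by exists H.*2; rewrite -[H.*2]addn0 cheb_period cheb0 eqxx addn0 double_gt0 H0.
case: (ex_minnP exm) => m /andP[m0 /eqP cm] mmin.
have hm : half_turn la m.
  split=> // k /andP[]; elim: k => // k IH _ km.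
  have nz : cheb la k.+1 != 0.
    by apply/negP => E; have := mmin k.+1; rewrite E /= leqNgt km => /(_ isT).
  case: k IH km nz => [|k] IH km nz; first by rewrite cheb1.
  have := IH isT (ltnW km); have := cheb_sign k.+1 => s p.
  by rewrite lt0r nz; rewrite pmulr_rge0 in s.
have dvd : (H <= m)%N.
  have qm (k : nat) : cone_ray (k + m.*2) = cone_ray k.
    apply/colP => l.
    have rec : chebrec la (fun k : nat => cone_ray k l 0).
      by move=> j; rewrite cone_raySS mxE [X in X + _]mxE [X in _ + X]mxE.
    by rewrite -addnn addnA !(chebrec_half_turn hm _ rec) opprK.
  have fix0 : mprod (walk m.*2) *m (ray true + ray false) = ray true + ray false.
    have := cone_rayS m.*2; rewrite odd_double -(add1n m.*2) qm cone_rayS mprod_nil mul1mx /= => E1.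
    have := qm 0%N; rewrite add0n /cone_ray odd_double mprod_nil mul1mx /= => E0.
    by rewrite mulmxDr E0 -E1.
  have pos i : 0 < (ray true + ray false) i 0.
    by rewrite !mxE; case: (col i); rewrite /= ?addr0 ?add0r.
  have [|z zP] := dominant_stab Hrep _ fix0; first by move=> i; apply/ltW.
  have -> : z = [::].
    by case: z zP => //= k z /andP[]; rewrite (gt_eqF (pos k)).
  rewrite walk_double gprod_nil => /eqP.
  by rewrite -order_dvdn => /dvdn_leq; apply.
have cH : cheb la H.*2 = 0 by rewrite -[H.*2]addn0 cheb_period.
have cH1 : cheb la H.*2.+1 = 1 by rewrite -addn1 cheb_period.
have rec : chebrec la (cheb la) by move=> k; rewrite chebSS.
(* With h the order: 2h < m contradicts the minimality of m; h < m < 2h would give the smaller zero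
   2h - m by antiperiodicity; m = 2h would force the value -1 at 2h + 1. *)
case: (ltngtP H.*2 m) => [lt|gt|E].
- have := cheb_eq0 hm (k := H.*2); rewrite cH eqxx lt double_gt0 H0.
  by move=> /(_ isT).
- suff -> : H = m by [].
  apply/eqP; rewrite eqn_leq dvd leqNgt; apply/negP => lt.
  have := chebrec_half_turn hm (H.*2 - m) rec; rewrite subnK; last exact: ltnW.
  rewrite cH => /eqP; rewrite eq_sym oppr_eq0; apply/negP.
  by apply: (cheb_eq0 hm); lia.
have := chebrec_half_turn hm 1 rec; rewrite add1n -E cH1 cheb1.
by move=> /eqP; rewrite -subr_eq0 opprK -mulr2n pnatr_eq0.
Qed.

Lemma rootval_zeros i y : (\sum_(1 <= j < (#[cox]%g.*2).+1) (rootval i y j == 0)%R = 2)%N.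
Proof.
have H := chebrec_count_zero cox_half_turn (rootval_rec i y)
  (rootval_sign i y) (rootval_neq0 i y).
rewrite (@big_cat_nat _ _ _ (1 + #[cox]%g)) //=; last by lia.
rewrite H (_ : #[cox]%g.*2.+1 = 1 + #[cox]%g + #[cox]%g)%N; last lia.
by rewrite H.
Qed.

(** The stabilizer of the dominant form [ray b] is generated by the letters of the other colour.
    These commute, so they are its only reflections. Conversely, a root negated by [gen k] is a
    multiple of [e k]. *)
Lemma root_ray_zero i y b : ((e i *m mprod y) *m ray b) 0 0 = 0 <->
  exists2 k, col k != b & (gen i ^ gprod y)%g = gen k.
Proof.
split=> [z|[k kb E]].
  have gs := root_sign Hrep y i.
  have fixb : mprod (refw (y, i)) *m ray b = ray b.
    have gc : (e i *m mprod y) *m ray b = 0 by rewrite [LHS]mx11_scalar z raddf0.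
    by rewrite (mprod_reflection Hrep) mulmxBl mul1mx -(mulmxA (G *m _)) gc mulmx0 subr0.
  have [|w wb wE] := dominant_stab Hrep _ fixb.
    by move=> l; rewrite mxE; case: ifP => // _; apply/ltW.
  have wJ : all (mem [set k | col k != b]) w.
    apply: sub_all wb => l /=; rewrite mxE inE.
    by case: (eqVneq (col l) b) => //= _; rewrite (gt_eqF (x_gt0 l)).
  rewrite gprod_conj // in wE.
  have [k [v [kJ vJ ->]]] := parabolic_reflection Hrep wJ wE.
  rewrite inE in kJ; exists k => //; apply: same_side_conj.
  apply: sub_all vJ => l /=; rewrite inE => lb.
  by move: kJ lb; case: (col k); case: (col l); case: (b).
have Em : mprod (rev y ++ i :: y) = sig k.
  rewrite (_ : sig k = mprod [:: k]); last by rewrite mprod_cons mprod_nil mulmx1.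
  by apply: (mprod_gprod Hrep); rewrite gprod_conj // gprod1.
set g := e i *m mprod y.
have : g *m sig k = - g.
  rewrite -Em mprod_cat mulmxA -(mulmxA (e i)) (mprod_revr Hrep) mulmx1.
  exact: e_cons.
rewrite act_sig => /eqP; rewrite subr_eq addrC -subr_eq opprK => /eqP E2.
have : 2 *: g *m ray b = (g *m G) 0 k *: (e k *m ray b).
  by rewrite scaler_nat mulr2n E2 scalemxAl.
have -> : e k *m ray b = 0.
  by rewrite -rowE; apply/rowP => l; rewrite !mxE (negPf kb).
rewrite scaler0 -scalemxAl => /eqP; rewrite scaler_eq0 pnatr_eq0 /= => /eqP ->.
by rewrite mxE.
Qed.

(* The inversions of the word of c: [init_refl k * c] is c with the letter k
   deleted. *)
Definition init_refl k : gT :=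
  if col k then gen k else (gen k ^ (gprod (side true))^-1)%g.

(** The letter slides to the front of its commuting colour class, where the reflection cancels
    it. *)
Lemma init_refl_cox k : exists2 l, perm_eq (k :: l) (side true ++ side false)
  & (init_refl k * cox)%g = gprod l.
Proof.
rewrite /init_refl /cox; case: (boolP (col k)) => ck.
  have kt : k \in side true by rewrite mem_side ck.
  have := filter_all [pred i | col i == true] (enum 'I_n).
  rewrite -/(side true); case/splitPr: (side true) / kt => l1 l2.
  rewrite all_cat => /andP[l1t _].
  exists (l1 ++ l2 ++ side false).
    by apply/seq.permP => p; rewrite /= !count_cat /= addnCA !addnA.
  have C := @same_side_gprod k l1; rewrite ck in C.
  rewrite -catA cat_cons !gprod_cat gprod_cons mulgA (C l1t).
  by rewrite -!mulgA (mulgA (gen k) (gen k)) gen_sq // mul1g gprod_cat.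
have kf : k \in side false by rewrite mem_side; case: (col k) ck.
have := filter_all [pred i | col i == false] (enum 'I_n).
rewrite -/(side false); case/splitPr: (side false) / kf => l1 l2.
rewrite all_cat => /andP[l1t _].
exists (side true ++ l1 ++ l2).
  apply/seq.permP => p; rewrite /= !count_cat /= addnCA.
  by congr (_ + _)%N; rewrite addnCA.
have C := @same_side_gprod k l1; rewrite (negPf ck) in C.
rewrite conjgE invgK !gprod_cat gprod_cons -!mulgA mulKg; congr (_ * _)%g.
by rewrite mulgA (C l1t) -!mulgA (mulgA (gen k) (gen k)) gen_sq // mul1g.
Qed.

Lemma count_gen (P : pred 'I_n) t :
  (\sum_(k | P k) (t == gen k) = [exists k, P k && (t == gen k)])%N.
Proof.
case: existsP => [[k /andP[Pk /eqP ->]]|no].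
  rewrite (bigD1 k) //= eqxx big1 // => l /andP[_ lk].
  by rewrite (inj_eq (cr_inj Hrep)) eq_sym (negPf lk).
rewrite big1 // => k Pk; apply/eqP; rewrite eqb0; apply/negP => tk.
by apply: no; exists k; rewrite Pk.
Qed.

(** A zero at index 2j + 1 means that the conjugate by c^j is [init_refl k] with [k] of colour
    [true]; a zero at 2j + 2 means the same with colour [false]. *)
Theorem reflection_count i y :
  (\sum_(j < #[cox]%g) \sum_k ((gen i ^ gprod y) ^ (cox ^+ j) == init_refl k)%g = 2)%N.
Proof.
rewrite -(rootval_zeros i y) big_add1 /=.
have D (F : nat -> nat) m : (\sum_(0 <= j < m.*2) F j = \sum_(j < m) (F j.*2 + F j.*2.+1))%N.
  elim: m => [|m IH]; first by rewrite big_geq // big_ord0.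
  by rewrite doubleS !big_nat_recr //= IH big_ord_recr /= addnA.
have Z (w : seq 'I_n) b : ((e i *m mprod y) *m (mprod w *m ray b)) 0 0 == 0
    = [exists k, (col k != b) && ((gen i ^ gprod y) ^ gprod w == gen k)%g].
  rewrite mulmxA -(mulmxA (e i)) -mprod_cat; apply/eqP/existsP.
    move=> /root_ray_zero[k kb E]; exists k.
    by rewrite kb -conjgM -gprod_cat E /=.
  move=> [k /andP[kb /eqP E]]; apply/root_ray_zero; exists k => //.
  by rewrite gprod_cat conjgM.
rewrite D; apply: eq_bigr => j _; rewrite (bigID col) /=; congr (_ + _)%N.
  rewrite /rootval cone_rayS odd_double Z walk_double -count_gen.
  apply: eq_big => k; first by case: (col k).
  by rewrite /init_refl => ->.
rewrite /rootval cone_rayS /= odd_double Z /= walkS odd_double gprod_cat walk_double -count_gen.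
apply: eq_big => k; first by case: (col k).
rewrite /init_refl => /negPf ->.
by rewrite -(inj_eq (conjg_inj (gprod (side true)))) conjgKV conjgM.
Qed.

End Bipartite.

(** * Counting *)

Section ReducedWords.
Variable gT : finGroupType.
Implicit Types (T : {set gT}) (c w x : gT) (p s t : seq gT).

Lemma reduced_prefix T c s t :
  reduced_word_for T c (s ++ t) -> reduced_word_for T (wprod s) s.
Proof.
case=> [[+ E] min]; rewrite all_cat => /andP[sT tT].
split=> // s' [s'T E']; have := min (s' ++ t).
rewrite !size_cat leq_add2r; apply; split; first by rewrite all_cat s'T.
by rewrite wprod_cat E' -wprod_cat.
Qed.

Lemma reduced_subst T c s t s' : reduced_word_for T c (s ++ t) ->
  reduced_word_for T (wprod s) s' -> reduced_word_for T c (s' ++ t).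
Proof.
move=> H [[s'T E] min']; case: (H) => [[+ Ec] min]; rewrite all_cat => /andP[sT tT].
split; first by split; [rewrite all_cat s'T | rewrite wprod_cat E -wprod_cat].
move=> r /min; apply: leq_trans.
by rewrite !size_cat leq_add2r; apply: min'; split.
Qed.

(** Counting prefixes of reduced words for [c] avoids the absolute order, and fixing the initial
    part [p] isolates the share of a first letter. *)
Definition num_ext T c p k : nat :=
  #|[set t : k.-tuple gT | `[< exists q, reduced_word_for T c (p ++ t ++ q) >]]|.

(** Any reduced word of an element below [c] may replace the prefix that witnesses the
    comparison. *)
Lemma TW_num_ext (V A : {set gT}) c k : TW V A c k = num_ext (reflections V A) c [::] k.
Proof.
apply: eq_card => t; rewrite !inE; apply/andP/asboolP.
  move=> [/asboolP[_ [p [q [red_p red_pq]]]] /asboolP red_t].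
  exists q; case: (red_p) => [[_ Ep] _].
  by apply: (reduced_subst red_pq); rewrite Ep.
move=> [q red]; have redt := @reduced_prefix _ _ t q red.
split; apply/asboolP => //; split; last by exists (tval t), q.
exists [::], (tval t); split=> //.
by split; first by split; rewrite ?wprod_nil.
Qed.

Lemma num_ext_cons T c k : num_ext T c [::] k.+1 = (\sum_(x in T) num_ext T c [:: x] k)%N.
Proof.
rewrite /num_ext -sum1dep_card.
pose f (u : gT * k.-tuple gT) : k.+1.-tuple gT := cons_tuple u.1 u.2.
have bf : {on [pred t : k.+1.-tuple gT | `[< exists q, reduced_word_for T c ([::] ++ t ++ q) >]],
    bijective f}.
  exists (fun t : k.+1.-tuple gT => (thead t, [tuple of behead t])) => [[x t] _|t _] /=.
    by rewrite theadE; congr (_, _); apply: val_inj.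
  by rewrite [RHS]tuple_eta; apply: val_inj.
rewrite (reindex _ bf) /= -(pair_big_dep predT
  (fun x (t : k.-tuple gT) => `[< exists q, reduced_word_for T c (x :: t ++ q) >]) (fun _ _ => 1%N)) /=.
rewrite [RHS]big_mkcond; apply: eq_bigr => x _ /=.
case: ifP => xT; first by rewrite sum1dep_card.
rewrite big_pred0 // => t; apply/negP => /asboolP[q [[/= /andP[+ _] _] _]].
by rewrite xT.
Qed.

Section Conj.
Variables (T : {set gT}) (w : gT).
Hypothesis Tw : forall x, ((x ^ w)%g \in T) = (x \in T).

Lemma wprod_conj s : wprod [seq (x ^ w)%g | x <- s] = ((wprod s) ^ w)%g.
Proof.
elim: s => [|x s IH]; first by rewrite wprod_nil conj1g.
by rewrite /= !wprod_cons IH conjMg.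
Qed.

Lemma word_conj c s :
  word_for T (c ^ w)%g [seq (x ^ w)%g | x <- s] <-> word_for T c s.
Proof.
rewrite /word_for wprod_conj all_map (eq_all (_ : _ =1 mem T)); last by move=> x /=; rewrite Tw.
by split=> -[sT E]; split=> //; [exact: conjg_inj E | rewrite E].
Qed.

Lemma conj_mapV s : exists s', s = [seq (x ^ w)%g | x <- s'].
Proof.
exists [seq (x ^ w^-1)%g | x <- s]; rewrite -map_comp -[LHS]map_id.
by apply: eq_map => x /=; rewrite conjgKV.
Qed.

Lemma reduced_conj c s :
  reduced_word_for T (c ^ w)%g [seq (x ^ w)%g | x <- s] <-> reduced_word_for T c s.
Proof.
split=> -[/word_conj ws min]; split=> // t.
  by move=> /word_conj /min; rewrite !size_map.
by have [t' ->] := conj_mapV t; move=> /word_conj /min; rewrite !size_map.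
Qed.

Lemma num_ext_conj c p k :
  num_ext T (c ^ w)%g [seq (x ^ w)%g | x <- p] k = num_ext T c p k.
Proof.
pose f (t : k.-tuple gT) : k.-tuple gT := map_tuple (fun x => (x ^ w)%g) t.
have fI : injective f.
  move=> s t /(congr1 val) /= /(inj_map (conjg_inj w)) E; exact: val_inj.
rewrite /num_ext -[RHS](card_imset _ fI); apply: eq_card => t; rewrite inE.
apply/asboolP/imsetP => [[q red]|[t' + ->]].
  have tE : t = f (map_tuple (fun x => (x ^ w^-1)%g) t).
    apply: val_inj; rewrite /= -map_comp -[LHS]map_id.
    by apply: eq_map => x /=; rewrite conjgKV.
  exists (map_tuple (fun x => (x ^ w^-1)%g) t) => //.
  have [q' qE] := conj_mapV q.
  rewrite inE; apply/asboolP; exists q'; move: red.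
  by rewrite {1}tE qE /= -!map_cat => /reduced_conj.
rewrite inE => /asboolP[q red]; exists [seq (x ^ w)%g | x <- q].
by rewrite /= -!map_cat; apply/reduced_conj.
Qed.
End Conj.
End ReducedWords.

(** * Cosine matrix of a Coxeter system *)

Lemma coxeter_rep_ex (R : realType) (gT : finGroupType) (W S : {set gT}) :
  coxeter_system W S ->
  exists a : 'I_#|S| -> 'I_#|S| -> R, coxeter_rep (@enum_val _ (mem S)) a.
Proof.
case=> SW ord pres.
(* One value is chosen per order m, so symmetry of the matrix reduces to symmetry of the orders. *)
have [f fP] : exists f : nat -> R, forall m, (1 < m)%N -> half_turn (f m) m.
  have ex m : exists b : R, (1 < m)%N -> half_turn b m.
    by case: (ltnP 1 m) => [/(half_turn_ex R)[b]|_]; [exists b | exists 0].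
  by exists (fun m => projT1 (cid (ex m))) => m; case: (cid (ex m)).
have inv (i : 'I_#|S|) : ((enum_val i)^-1 = enum_val i)%g.
  by rewrite invg_expg ord ?enum_valP // expg1.
exists (fun i j => f #[enum_val i * enum_val j]%g); split.
- exact: enum_val_inj.
- by move=> i; apply: ord; apply: enum_valP.
- by move=> i j; rewrite -[in LHS]orderV invMg !inv.
- move=> i j ij; apply: fP; rewrite ltnNge; apply/negP => o1.
  have : #[enum_val i * enum_val j]%g == 1%N by rewrite eqn_leq o1 order_gt0.
  rewrite order_eq1 -eq_invg_mul inv.
  by rewrite (inj_eq enum_val_inj) (negPf ij).
move=> u v E; rewrite (_ : _ @: setT = S); last first.
  apply/setP => s; apply/imsetP/idP => [[i _ ->]|sS]; first exact: enum_valP.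
  by exists (enum_rank_in sS s); rewrite ?enum_rankK_in.
by apply: pres E; apply/allP => s /mapP[i _ ->]; apply: enum_valP.
Qed.

(** * Reduced reflection words of Coxeter elements *)

Section Counting.
Variables (gT : finGroupType) (n : nat) (gen : 'I_n -> gT) (R : realFieldType)
  (a : 'I_n -> 'I_n -> R).
Hypothesis Hrep : coxeter_rep gen a.
Implicit Types (i j k : 'I_n) (u v l y : seq 'I_n) (J : {set 'I_n}).
Local Notation gprod := (gprod gen).
Let gen_ord := cr_ord Hrep.
Let T := reflections <<gen @: setT>>%g (gen @: setT).

Lemma reflectionsP J x : reflect (exists j z, [/\ j \in J, all (mem J) z & x = (gen j ^ gprod z)%g])
  (x \in reflections <<gen @: J>>%g (gen @: J)).
Proof.
apply: (iffP imset2P) => [[_ w /imsetP[j jJ ->] /gprod_genP[z zJ <-] ->]|[j [z [jJ zJ ->]]]].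
  by exists j, z.
exists (gen j) (gprod z) => //; first exact: imset_f.
by apply/gprod_genP; exists z.
Qed.

Lemma reflections_conj (A : {set gT}) w x : w \in <<A>>%g ->
  ((x ^ w)%g \in reflections <<A>>%g A) = (x \in reflections <<A>>%g A).
Proof.
have H (v y : gT) : v \in <<A>>%g -> y \in reflections <<A>>%g A -> (y ^ v)%g \in reflections <<A>>%g A.
  move=> vA /imset2P[s z sA zA ->]; apply/imset2P; exists s (z * v)%g => //.
    exact: groupM.
  by rewrite conjgM.
move=> wA; apply/idP/idP; last exact: H.
by move=> /(H w^-1%g _); rewrite groupV conjgK; apply.
Qed.

Lemma allT u : all (mem [set: 'I_n]) u.
Proof. by apply/allP => i _; rewrite inE. Qed.

Lemma reflections_sub J x : x \in reflections <<gen @: J>>%g (gen @: J) -> x \in T.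
Proof.
by move=> /reflectionsP[j [z [_ _ ->]]]; apply/reflectionsP; exists j, z; rewrite inE allT.
Qed.

Lemma reflection_words s : all (mem T) s -> exists rs, s = map (word_refl gen) rs.
Proof.
elim: s => [|x s IH] /=; first by exists [::].
move=> /andP[/reflectionsP[j [z [_ _ ->]]] /IH[rs ->]].
by exists ((z, j) :: rs).
Qed.

Lemma wprod_refl rs : wprod (map (word_refl gen) rs) = gprod (flatten (map (@refw n) rs)).
Proof.
elim: rs => [|p rs IH]; first by rewrite gprod_nil wprod_nil.
by rewrite /= wprod_cons IH gprod_cat (gprod_refw Hrep).
Qed.

Lemma word_coxeter l s : uniq l -> word_for T (gprod l) s ->
  (size l <= size s)%N /\ (size s = size l ->
    all (mem (reflections <<gen @: [set i | i \in l]>>%g (gen @: [set i | i \in l]))) s).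
Proof.
move=> ul [sT E]; have [rs rsE] := reflection_words sT.
rewrite rsE wprod_refl in E.
have [le eq] := coxeter_reflection_word Hrep ul (esym E).
rewrite rsE size_map; split=> // /eq H.
apply/allP => x /mapP[p prs ->]; apply/reflectionsP.
have [j [z [jl zl ->]]] := H p prs; exists j, z; rewrite inE; split=> //.
by apply: sub_all zl => i /=; rewrite inE.
Qed.

Lemma gen_reflection J i : i \in J -> gen i \in reflections <<gen @: J>>%g (gen @: J).
Proof.
move=> iJ; apply/reflectionsP; exists i, [::].
by rewrite gprod_nil conjg1.
Qed.

(** The simple letters of [l] attain the lower bound of [word_coxeter], so being reduced is a
    condition on the length alone. *)
Lemma reduced_coxeter J l s : uniq l -> {subset l <= J} ->
  reduced_word_for (reflections <<gen @: J>>%g (gen @: J)) (gprod l) s <->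
  word_for (reflections <<gen @: J>>%g (gen @: J)) (gprod l) s /\ size s = size l.
Proof.
move=> ul lJ; set TJ := reflections _ _.
have wT t : word_for TJ (gprod l) t -> word_for T (gprod l) t.
  by case=> tJ E; split=> //; apply: sub_all tJ => x; apply: reflections_sub.
have ge t : word_for TJ (gprod l) t -> (size l <= size t)%N.
  by move=> /wT /(word_coxeter ul)[].
split=> [[ws min]|[ws sz]]; split=> //; last by move=> t /ge; rewrite sz.
apply/eqP; rewrite eqn_leq ge // andbT -(size_map gen l); apply: min.
by split=> //; apply/allP => x /mapP[i il ->]; apply/gen_reflection/lJ.
Qed.

(** By Carter's lemma a shortest word in all reflections uses only those of the parabolic
    subgroup. *)
Lemma reduced_parabolic J l s : uniq l -> l =i J ->
  reduced_word_for T (gprod l) s <->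
  reduced_word_for (reflections <<gen @: J>>%g (gen @: J)) (gprod l) s.
Proof.
move=> ul lJ; have JE : [set i | i \in l] = J by apply/setP => i; rewrite inE lJ.
rewrite (reduced_coxeter _ ul) => [|i]; last by rewrite lJ.
rewrite (reduced_coxeter (J := setT)) // => [|i]; last by rewrite inE.
split=> -[ws sz]; split=> //; case: (ws) => sT E; split=> //.
  by rewrite -JE; have [_ /(_ sz)] := word_coxeter ul ws.
by apply: sub_all sT => x; apply: reflections_sub.
Qed.

Lemma coxeter_element_conj J l l' : uniq l -> uniq l' -> l =i J -> l' =i J ->
  exists2 g, g \in <<gen @: J>>%g & gprod l' = (gprod l ^ g)%g.
Proof.
move=> ul ul' lJ l'J.
have P : perm_eq l l' by apply: uniq_perm => // i; rewrite lJ l'J.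
have M := cox_move_perm_eq (nbr_sym Hrep) (leaf_ex Hrep) ul P.
have [|g gJ E] := cox_move_conj (nbrN_commute Hrep) (H := generated_group (gen @: J)) _ M.
  by move=> i; rewrite lJ => iJ; rewrite mem_gen // imset_f.
by exists g => //; rewrite /gprod /wprod !big_map.
Qed.

Lemma coxeter_element_word J c : coxeter_element (gen @: J) c ->
  exists l, [/\ uniq l, l =i J & gprod l = c].
Proof.
case=> r rP ->.
have rJ x : (x \in r) = (x \in gen @: J) by rewrite (perm_mem rP) mem_enum.
have [l lr] : exists l, r = map gen l.
  have : {subset r <= gen @: J} by move=> x; rewrite rJ.
  elim: (r) => [|x s IH] sub; first by exists [::].
  have /imsetP[i _ xi] : x \in gen @: J by apply: sub; rewrite mem_head.
  have [|l ->] := IH; first by move=> z zs; apply: sub; rewrite inE zs orbT.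
  by exists (i :: l); rewrite xi.
exists l; rewrite lr; split=> //.
  by rewrite -(map_inj_uniq (cr_inj Hrep)) -lr (perm_uniq rP) enum_uniq.
move=> i; rewrite -(mem_map (cr_inj Hrep)) -lr rJ.
by rewrite (mem_imset _ _ (cr_inj Hrep)).
Qed.

Lemma TW_conj J c c' (k : nat) : coxeter_element (gen @: J) c -> coxeter_element (gen @: J) c' ->
  TW <<gen @: J>>%g (gen @: J) c k = TW <<gen @: J>>%g (gen @: J) c' k.
Proof.
move=> /coxeter_element_word[l [ul lJ <-]] /coxeter_element_word[l' [ul' l'J <-]].
have [g gJ ->] := coxeter_element_conj ul ul' lJ l'J.
rewrite !TW_num_ext -(num_ext_conj (w := g)) //.
by move=> x; apply: reflections_conj.
Qed.

Lemma coxeter_element_order c c' : coxeter_element (gen @: setT) c ->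
  coxeter_element (gen @: setT) c' -> #[c]%g = #[c']%g.
Proof.
move=> /coxeter_element_word[l [ul lJ <-]] /coxeter_element_word[l' [ul' l'J <-]].
have [g gJ ->] := coxeter_element_conj ul ul' lJ l'J.
by rewrite orderJ.
Qed.

(** * Double counting over the bipartite Coxeter element *)

Section Irreducible.
Variables (col : 'I_n -> bool) (i0 : 'I_n) (x : 'I_n -> R) (la : R).
Hypotheses (Hcol : forall i j, nbr gen i j -> col i != col j) (i0_col : col i0)
  (x_gt0 : forall i, 0 < x i)
  (x_eig : forall i, \sum_(j | j != i) a i j * x j = la * x i).
Local Notation cox := (cox gen col).
Local Notation init_refl := (init_refl gen col).

Lemma cox_word : [/\ uniq (side col true ++ side col false),
  side col true ++ side col false =i setT & gprod (side col true ++ side col false) = cox].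
Proof.
split=> //; last by move=> i; rewrite mem_cat !mem_side inE; case: (col i).
rewrite cat_uniq !side_uniq andbT /=; apply/hasPn => i.
by rewrite !mem_side => /eqP ->.
Qed.

Lemma init_refl_in k : init_refl k \in T.
Proof.
rewrite /init_refl; case: ifP => _; first by apply: gen_reflection; rewrite inE.
rewrite reflections_conj ?gen_reflection ?inE // groupV.
by apply/gprod_genP; exists (side col true); rewrite ?allT.
Qed.

(** Removing the first letter from a reduced word of c leaves a reduced word of c without [k], a
    Coxeter element of the parabolic subgroup. *)
Lemma num_ext_init k K : exists2 c, coxeter_element (gen @: [set~ k]) c &
  num_ext T cox [:: init_refl k] K = TW <<gen @: [set~ k]>>%g (gen @: [set~ k]) c K.
Proof.
have [ur rT rE] := cox_word.
have [l lP lE] := init_refl_cox Hrep Hcol k.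
have /= /andP[kl ul] : uniq (k :: l) by rewrite (perm_uniq lP).
have lJ : l =i [set~ k].
  move=> i; have := perm_mem lP i; rewrite rT !inE.
  by case: eqVneq => [->|_] //=; rewrite (negPf kl).
exists (gprod l).
  exists (map gen l) => //; apply: uniq_perm.
  - by rewrite (map_inj_uniq (cr_inj Hrep)).
  - exact: enum_uniq.
  move=> y; rewrite mem_enum; apply/mapP/imsetP => -[i il ->]; exists i => //.
    by rewrite -lJ.
  by rewrite lJ.
rewrite TW_num_ext; apply: eq_card => t; rewrite !inE.
have sq : (init_refl k * init_refl k = 1)%g.
  rewrite /init_refl; case: ifP => _; first exact: gen_sq.
  by rewrite -conjMg gen_sq // conj1g.
have E q : reduced_word_for T cox (init_refl k :: t ++ q) <->
    reduced_word_for (reflections <<gen @: [set~ k]>>%g (gen @: [set~ k])) (gprod l) (t ++ q).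
  rewrite -(reduced_parabolic _ ul lJ) -rE.
  rewrite !(reduced_coxeter (J := setT)) // => [|i|i]; rewrite ?inE //.
  rewrite /word_for /= init_refl_in /= wprod_cons rE -lE -(perm_size lP) /=.
  split=> -[[sT Ep] sz]; split.
  - by split=> //; rewrite -Ep mulgA sq mul1g.
  - by case: sz.
  - by split=> //; rewrite Ep mulgA sq mul1g.
  - by rewrite sz.
by apply: asbool_equiv_eq; split=> -[q /E H]; exists q.
Qed.

(** Count triples (t, j, k) with c^-j t c^j = [init_refl k], weighted by the extensions of t: each t
    occurs twice, and each pair (j, k) determines t. *)
Lemma TW_cox K :
  (2 * TW <<gen @: setT>>%g (gen @: setT) cox K.+1
   = #[cox]%g * \sum_k num_ext T cox [:: init_refl k] K)%N.
Proof.
rewrite TW_num_ext num_ext_cons mulnC big_distrl /= -/T.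
pose F t := num_ext T cox [:: t] K.
have coxW (j : nat) : (cox ^+ j)%g \in <<gen @: setT>>%g.
  by apply: groupX; apply/gprod_genP; exists (side col true ++ side col false); rewrite ?allT.
have FJ (j : nat) t : F (t ^ (cox ^+ j))%g = F t.
  rewrite /F -[in RHS](num_ext_conj (w := (cox ^+ j)%g)) /=; last first.
    by move=> y; apply: reflections_conj.
  by rewrite [(cox ^ _)%g]conjgE -expgS expgSr mulKg.
transitivity (\sum_(t in T) \sum_(j < #[cox]%g) \sum_k
    (F t * ((t ^ (cox ^+ j) == init_refl k)%g : nat)))%N.
  apply: eq_bigr => t /reflectionsP[i [y [_ _ ->]]].
  have := reflection_count Hrep Hcol i0_col x_gt0 x_eig i y => <-.
  rewrite big_distrr; apply: eq_bigr => j _.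
  by rewrite big_distrr.
rewrite exchange_big /= (eq_bigr (fun=> \sum_k num_ext T cox [:: init_refl k] K)%N).
  by rewrite sum_nat_const card_ord.
move=> j _; rewrite exchange_big /=; apply: eq_bigr => k _.
pose t0 := (init_refl k ^ (cox ^+ j)^-1)%g.
have t0T : t0 \in T by rewrite reflections_conj ?groupV ?coxW ?init_refl_in.
rewrite (bigD1 t0) //= big1 => [|t /andP[_ tt]].
  by rewrite addn0 conjgKV eqxx muln1 -/(F _) -(FJ j t0) conjgKV.
apply/eqP; rewrite muln_eq0 eqb0; apply/orP; right.
by apply: contra tt => /eqP E; rewrite /t0 -E conjgK.
Qed.

End Irreducible.
End Counting.

Theorem corollary3p7 (gT : finGroupType) (W : {group gT}) (S : {set gT})
    (h k : nat) (c : gT) (cs : gT -> gT)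
    (hWS : coxeter_system W S)
    (hirr : coxeter_irreducible S)
    (hh : coxeter_number S h)
    (hk : (1 <= k)%N)
    (hc : coxeter_element S c)
    (hcs : forall s, s \in S -> coxeter_element (S :\ s) (cs s)) :
  (TW W S c k)%:R
  = h%:R / 2%:R *
    \sum_(s in S) (TW <<S :\ s>>%g (S :\ s) (cs s) (k - 1))%:R :> rat.
Proof.
have [a Hrep] := coxeter_rep_ex Rdefinitions.R hWS.
set gen := @enum_val gT (mem S) in Hrep.
have genS : gen @: setT = S.
  apply/setP => s; apply/imsetP/idP => [[i _ ->]|sS]; first exact: enum_valP.
  by exists (enum_rank_in sS s); rewrite /gen ?enum_rankK_in.
have genSD i : gen @: [set~ i] = S :\ gen i.
  apply/setP => s; rewrite in_setD1; apply/imsetP/andP => [[j ji ->]|[si sS]].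
    by rewrite (inj_eq enum_val_inj) -in_setC1 enum_valP.
  exists (enum_rank_in sS s); rewrite /gen ?enum_rankK_in // in_setC1.
  by apply: contra si => /eqP <-; rewrite /gen enum_rankK_in.
case: hirr => /set0Pn[s0 s0S] conn.
pose i0 := enum_rank_in s0S s0.
have gi0 : gen i0 = s0 by apply: enum_rankK_in.
have [col0 Hcol0] := forest_coloring (nbr_sym Hrep) (leaf_ex Hrep) (@nbrI _ _ gen).
(* Normalised so that [i0] has colour [true], the colour of the first ray. *)
pose col i := col0 i == col0 i0.
have Hcol i j : nbr gen i j -> col i != col j.
  by move=> /Hcol0; rewrite /col; case: (col0 i); case: (col0 j); case: (col0 i0).
have i0_col : col i0 by exact: eqxx.
(* The half-turn condition constrains [a] only off the diagonal, which is therefore set to 0 to get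
   a nonnegative matrix. *)
pose A i j : Rdefinitions.R := if j == i then 0 else a i j.
have A_sym i j : A i j = A j i by rewrite /A eq_sym; case: ifP => // _; apply: cr_sym Hrep _ _.
have A_ge0 i j : 0 <= A i j.
  rewrite /A; case: eqVneq => // ji; rewrite eq_sym in ji.
  exact: half_turn_ge0 (cr_half Hrep ji).
have A_conn i j : connect [rel i j | 0 < A i j] i j.
  have /connectP[p pth lst] := conn _ _ (enum_valP i) (enum_valP j).
  elim: p i pth lst => [|s p IH] i /=; first by move=> _ /enum_val_inj ->.
  move=> /andP[/and3P[_ sS o2] pth] lst.
  have sE : s = gen (enum_rank_in sS s) by rewrite /gen enum_rankK_in.
  rewrite sE in pth lst o2.
  apply: connect_trans (IH _ pth lst); apply: connect1 => /=.
  rewrite /A; case: eqVneq => [E|ji].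
    by move: o2; rewrite E (gen_sq (cr_ord Hrep)) order1.
  rewrite eq_sym in ji; apply: lt_le_trans (half_turn_ge1 (cr_half Hrep ji) o2).
  exact: ltr01.
have [x [la [x_gt0 eig]]] := perron_frobenius A_sym A_ge0 A_conn i0.
have x_eig i : \sum_(j | j != i) a i j * x j = la * x i.
  rewrite -eig big_mkcond; apply: eq_bigr => j _; rewrite /A.
  by case: eqVneq; rewrite ?mul0r.
have cox_el : coxeter_element (gen @: setT) (cox gen col).
  have [ur rT rE] := cox_word gen col.
  exists (map gen (side col true ++ side col false)); last by rewrite -rE.
  apply: uniq_perm; rewrite ?(map_inj_uniq (cr_inj Hrep)) ?enum_uniq // => s.
  by rewrite mem_enum; apply/mapP/imsetP => -[i _ ->]; exists i; rewrite ?rT ?inE.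
case: hh => c' c'el ->; case: k hk => // K _; rewrite subn1 /=.
have SW : <<S>>%g = W by case: hWS.
rewrite -genS in hc c'el.
have -> : TW W S c K.+1 = TW <<gen @: setT>>%g (gen @: setT) (cox gen col) K.+1.
  by rewrite -(TW_conj Hrep K.+1 hc cox_el) genS SW.
rewrite (coxeter_element_order Hrep c'el cox_el).
have E := TW_cox Hrep Hcol i0_col x_gt0 x_eig K.
have two0 : (2 : rat) != 0 by [].
apply: (mulfI two0); rewrite mulrA mulrCA mulfV // mulr1 -natrM E natrM; congr (_ * _).
rewrite natr_sum [RHS]big_enum_val; apply: eq_bigr => i _; congr (_%:R).
(* The Coxeter element left by deleting a letter may differ from the given one, but the two are
   conjugate in the parabolic subgroup. *)
have [cc cc_el ->] := num_ext_init Hrep Hcol i K.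
rewrite -/(gen i) -!(genSD i); apply: (TW_conj Hrep _ cc_el).
by rewrite genSD; apply/hcs/enum_valP.
Qed.
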